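(* Assume (A$_1$)–(A$_7$). Then $f$ is in the weak fine core of $\mathcal E$ if and only if $f$ is in the private core of $\mathcal E^s$.
   Context: Standing setup (mixed economy $\mathcal E$). $\Omega$ is a finite set of states with a $\sigma$-algebra $\mathcal F$. $(T,\Sigma,\mu)$ is a complete, finite, positive measure space of agents; $T=T_0\cup T_1$, $T_0$ atomless, $T_1$ a countable union of $\mu$-atoms, each atom being one agent. $Y$ is an ordered Banach space whose positive cone $Y_+$ has nonempty interior; $x\gg0$ means $x\in\operatorname{int}Y_+$. Each agent $t$ has a partition $\Pi_t$ of $\Omega$ generating $\mathcal F_t$, a utility $U_t:\Omega\times Y_+\to\mathbb R$, an endowment $a(t,\cdot):\Omega\to Y_+$ constant on elements of $\Pi_t$, a prior $q_t$ with $q_t(\omega)>0$; $V_t(x)=\sum_\omega U_t(\omega,x(\omega))q_t(\omega)$; $a(\cdot,\omega)$ is Bochner integrable on $T$. A coalition is $S\in\Sigma$ with $\mu(S)>0$. An $S$-assignment is $f:S\times\Omega\to Y_+$ with $f(\cdot,\omega)$ Bochner integrable on $S$ for each $\omega$; it is $S$-exactly feasible if $\int_S f(\cdot,\omega)d\mu=\int_S a(\cdot,\omega)d\mu$ for all $\omega$; a $T$-assignment is feasible if $\int_T f(\cdot,\omega)d\mu\le\int_T a(\cdot,\omega)d\mu$ for all $\omega$. For a partition $\mathcal Q$, $T_{\mathcal Q}=\{t:\Pi_t=\mathcal Q\}$; $\mathfrak P_S=\{\mathcal Q:S\cap T_{\mathcal Q}\ne\emptyset\}$; $\bigvee\mathfrak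 P_S$ is the $\sigma$-algebra generated by the coarsest common refinement of the partitions in $\mathfrak P_S$. An assignment $f$ is NY-fine blocked by a coalition $S$ if there is an $S$-exactly feasible $S$-assignment $g$ with $g(t,\cdot)$ $\bigvee\mathfrak P_S$-measurable and $V_t(g(t,\cdot))>V_t(f(t,\cdot))$ for a.e. $t\in S$. The weak fine core of $\mathcal E$ is the set of feasible assignments $f$ with $f(t,\cdot)$ $\bigvee\mathfrak P_T$-measurable for a.e. $t$ that are not NY-fine blocked by any coalition. $\mathcal E^s$ is the economy identical to $\mathcal E$ except that every agent's information is $\bigvee\mathfrak P_T$. In $\mathcal E^s$: an $S$-allocation is an $S$-assignment $g$ with $g(t,\cdot)$ $\bigvee\mathfrak P_T$-measurable for a.e. $t\in S$; $S$ privately blocks an allocation $f$ if there is an $S$-allocation $g$ with $\int_S g(\cdot,\omega)d\mu\le\int_S a(\cdot,\omega)d\mu$ for all $\omega$ and $V_t(g(t,\cdot))>V_t(f(t,\cdot))$ for a.e. $t\in S$; the private core of $\mathcal E^s$ is the set of feasible allocations of $\mathcal E^s$ not privately blocked by any coalition. (A$_1$): $t\mapsto q_t$ is measurable and $T_{\mathcal Q}\in\Sigma$ for every partition $\mathcal Q$. (A$_2$): for each $\omega$, $t\mapsto U_t(\omega,x)$ is measurable and $U_t(\omega,\cdot)$ is norm-continuous. (A$_3$): for all $(t,\omega)$ and $x,y\in Y_+$ with $y\gg0$, $U_t(\omega,x+y)>U_t(\omega,x)$. (A$_4$): for each $(t_0,\omega_0)\in T_1\times\Omega$ and each coalition $S$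 with $\mu(S\cap T_1)>0$ and $S$-assignment $f$ with $\int_S f(\cdot,\omega)d\mu\le\int_S a(\cdot,\omega)d\mu$ for all $\omega$, $U_{t_0}(\omega_0,\hat f(\omega_0))\ge\frac{1}{\mu(S\cap T_1)}\int_{S\cap T_1}U_{t_0}(\omega_0,f(\cdot,\omega_0))d\mu$ where $\hat f(\omega_0)=\frac{1}{\mu(S\cap T_1)}\int_{S\cap T_1}f(\cdot,\omega_0)d\mu$. (A$_5$): $a(t,\omega)\gg0$ for all $(t,\omega)$. (A$_6$): all large agents have the same characteristics. (A$_7$): $T_1$ contains at least two atoms. *)

(* Defs.v *)
From HB Require Import structures.
From mathcomp Require Import all_boot all_order all_algebra.
From mathcomp Require Import all_classical all_reals all_analysis.
Set Implicit Arguments.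
Unset Strict Implicit.
Unset Printing Implicit Defensive.
Import Order.TTheory GRing.Theory Num.Theory.
Import numFieldNormedType.Exports.
Local Open Scope classical_set_scope.
Local Open Scope ring_scope.

Section Economy.
Context {d : measure_display} {T : measurableType d} {R : realType}
  {Y : completeNormedModType R} {Om : finType}.

Definition ordered_banach_cone (Yp : set Y) : Prop :=
  [/\ closed Yp, Yp 0,
      (forall x y, Yp x -> Yp y -> Yp (x + y)) /\
      (forall (c : R) x, 0 <= c -> Yp x -> Yp (c *: x)),
      (forall x, Yp x -> Yp (- x) -> x = 0) &
      (exists x, (interior Yp) x)].

Definition yle (Yp : set Y) (x y : Y) : Prop := Yp (y - x).

Definition ygg0 (Yp : set Y) (x : Y) : Prop := (interior Yp) x.

Definition simple_fun (s : seq (set T * Y)) (t : T) : Y :=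
  \sum_(p <- s) (\1_p.1 t : R) *: p.2.

Definition simple_int (mu : {measure set T -> \bar R}) (S : set T)
  (s : seq (set T * Y)) : Y :=
  \sum_(p <- s) fine (mu (p.1 `&` S)) *: p.2.

Definition is_bochner_int (mu : {measure set T -> \bar R}) (S : set T)
  (h : T -> Y) (v : Y) : Prop :=
  exists s : nat -> seq (set T * Y),
    [/\ (forall n, all (fun p => `[< measurable p.1 >]) (s n)),
        (forall n, measurable_fun S (fun t => `|h t - simple_fun (s n) t|)),
        (fun n => (\int[mu]_(t in S) (`|h t - simple_fun (s n) t|)%:E)%E)
           @ \oo --> (0 : \bar R) &
        (fun n => simple_int mu S (s n)) @ \oo --> v].

Definition bochner_integrable (mu : {measure set T -> \bar R}) (S : set T)
  (h : T -> Y) : Prop := exists v, is_bochner_int mu S h v.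

Definition bint (mu : {measure set T -> \bar R}) (S : set T) (h : T -> Y) : Y :=
  xget 0 [set v | is_bochner_int mu S h v].

Definition atomless_on (mu : {measure set T -> \bar R}) (A : set T) : Prop :=
  forall B, measurable B -> B `<=` A -> (0 < mu B)%E ->
    exists C, [/\ measurable C, C `<=` B, (0 < mu C)%E & (mu C < mu B)%E].

(* (T,Sigma,mu) complete, finite, positive; T = T0 \cup T1 with T0 = ~` T1
   atomless and T1 a countable set of atoms, each atom being a single agent. *)
Definition agent_space (mu : {measure set T -> \bar R}) (T1 : set T) : Prop :=
  [/\ measure_is_complete mu, (mu setT < +oo)%E,
      countable T1,
      (forall t, T1 t -> measurable [set t] /\ (0 < mu [set t])%E) &
      atomless_on mu (~` T1)].

Definition coalition (mu : {measure set T -> \bar R}) (S : set T) : Prop :=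
  measurable S /\ (0 < mu S)%E.

Definition is_partition (P : {set {set Om}}) : Prop := finset.partition P [set: Om].

(* x : Om -> Y is measurable w.r.t. the sigma-algebra generated by P *)
Definition part_meas (P : {set {set Om}}) (x : Om -> Y) : Prop :=
  forall w w', w' \in finset.pblock P w -> x w = x w'.

(* ω, ω' lie in the same cell of the coarsest common refinement of the
   partitions in 𝔓_S = {Π_t : t ∈ S} *)
Definition join_rel (Pi : T -> {set {set Om}}) (S : set T) (w w' : Om) : Prop :=
  forall t, S t -> w' \in finset.pblock (Pi t) w.

Definition join_meas (Pi : T -> {set {set Om}}) (S : set T) (x : Om -> Y) : Prop :=
  forall w w', join_rel Pi S w w' -> x w = x w'.

Definition Vexp (U : T -> Om -> Y -> R) (q : T -> Om -> R) (t : T)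
  (x : Om -> Y) : R := \sum_(w : Om) U t w (x w) * q t w.

Definition assignment (mu : {measure set T -> \bar R}) (Yp : set Y)
  (S : set T) (f : T -> Om -> Y) : Prop :=
  (forall t w, S t -> Yp (f t w)) /\
  (forall w, bochner_integrable mu S (fun t => f t w)).

Definition exactly_feasible (mu : {measure set T -> \bar R}) (a : T -> Om -> Y)
  (S : set T) (f : T -> Om -> Y) : Prop :=
  forall w, bint mu S (fun t => f t w) = bint mu S (fun t => a t w).

Definition weakly_feasible (mu : {measure set T -> \bar R}) (Yp : set Y)
  (a : T -> Om -> Y) (S : set T) (f : T -> Om -> Y) : Prop :=
  forall w, yle Yp (bint mu S (fun t => f t w)) (bint mu S (fun t => a t w)).

Definition feasible (mu : {measure set T -> \bar R}) (Yp : set Y)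
  (a : T -> Om -> Y) (f : T -> Om -> Y) : Prop :=
  assignment mu Yp setT f /\ weakly_feasible mu Yp a setT f.

Definition NY_fine_blocked (mu : {measure set T -> \bar R}) (Yp : set Y)
  (Pi : T -> {set {set Om}}) (U : T -> Om -> Y -> R) (q : T -> Om -> R)
  (a : T -> Om -> Y) (f : T -> Om -> Y) (S : set T) : Prop :=
  exists g : T -> Om -> Y,
    [/\ assignment mu Yp S g, exactly_feasible mu a S g,
        (forall t, S t -> join_meas Pi S (g t)) &
        {ae mu, forall t, S t -> Vexp U q t (g t) > Vexp U q t (f t)}].

Definition weak_fine_core (mu : {measure set T -> \bar R}) (Yp : set Y)
  (Pi : T -> {set {set Om}}) (U : T -> Om -> Y -> R) (q : T -> Om -> R)
  (a : T -> Om -> Y) (f : T -> Om -> Y) : Prop :=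
  [/\ feasible mu Yp a f,
      {ae mu, forall t, join_meas Pi setT (f t)} &
      forall S, coalition mu S -> ~ NY_fine_blocked mu Yp Pi U q a f S].

(* ---------- private core of E^s (all agents informed by \/ 𝔓_T) ---------- *)
Definition allocation_s (mu : {measure set T -> \bar R}) (Yp : set Y)
  (Pi : T -> {set {set Om}}) (S : set T) (g : T -> Om -> Y) : Prop :=
  assignment mu Yp S g /\ {ae mu, forall t, S t -> join_meas Pi setT (g t)}.

Definition privately_blocked (mu : {measure set T -> \bar R}) (Yp : set Y)
  (Pi : T -> {set {set Om}}) (U : T -> Om -> Y -> R) (q : T -> Om -> R)
  (a : T -> Om -> Y) (f : T -> Om -> Y) (S : set T) : Prop :=
  exists g : T -> Om -> Y,
    [/\ allocation_s mu Yp Pi S g, weakly_feasible mu Yp a S g &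
        {ae mu, forall t, S t -> Vexp U q t (g t) > Vexp U q t (f t)}].

Definition private_core_s (mu : {measure set T -> \bar R}) (Yp : set Y)
  (Pi : T -> {set {set Om}}) (U : T -> Om -> Y -> R) (q : T -> Om -> R)
  (a : T -> Om -> Y) (f : T -> Om -> Y) : Prop :=
  [/\ allocation_s mu Yp Pi setT f, weakly_feasible mu Yp a setT f &
      forall S, coalition mu S -> ~ privately_blocked mu Yp Pi U q a f S].

Definition economy (mu : {measure set T -> \bar R}) (T1 : set T) (Yp : set Y)
  (Pi : T -> {set {set Om}}) (U : T -> Om -> Y -> R) (q : T -> Om -> R)
  (a : T -> Om -> Y) : Prop :=
  [/\ agent_space mu T1, ordered_banach_cone Yp /\
      (forall t, is_partition (Pi t)),
      (forall t w, Yp (a t w)) /\ (forall t, part_meas (Pi t) (a t)),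
      (forall t w, 0 < q t w) /\ (forall t, \sum_(w : Om) q t w = 1) &
      (forall w, bochner_integrable mu setT (fun t => a t w))].

Definition A1 (mu : {measure set T -> \bar R})
  (Pi : T -> {set {set Om}}) (q : T -> Om -> R) : Prop :=
  (forall w, measurable_fun setT (fun t => q t w)) /\
  (forall Q : {set {set Om}}, measurable [set t | Pi t = Q]).

Definition A2 (Yp : set Y) (U : T -> Om -> Y -> R) : Prop :=
  (forall w x, Yp x -> measurable_fun setT (fun t => U t w x)) /\
  (forall t w, {within Yp, continuous (U t w)}).

Definition A3 (Yp : set Y) (U : T -> Om -> Y -> R) : Prop :=
  forall t w x y, Yp x -> Yp y -> ygg0 Yp y -> U t w (x + y) > U t w x.

Definition A4 (mu : {measure set T -> \bar R}) (T1 : set T) (Yp : set Y)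
  (U : T -> Om -> Y -> R) (a : T -> Om -> Y) : Prop :=
  forall t0 w0, T1 t0 ->
  forall S (f : T -> Om -> Y), coalition mu S -> (0 < mu (S `&` T1))%E ->
    assignment mu Yp S f -> weakly_feasible mu Yp a S f ->
    let m := fine (mu (S `&` T1)) in
    let fhat := m^-1 *: bint mu (S `&` T1) (fun t => f t w0) in
    ((m^-1)%:E * \int[mu]_(t in S `&` T1) (U t0 w0 (f t w0))%:E
       <= (U t0 w0 fhat)%:E)%E.

Definition A5 (Yp : set Y) (a : T -> Om -> Y) : Prop :=
  forall t w, ygg0 Yp (a t w).

Definition A6 (T1 : set T) (Pi : T -> {set {set Om}}) (U : T -> Om -> Y -> R)
  (q : T -> Om -> R) (a : T -> Om -> Y) : Prop :=
  forall t t', T1 t -> T1 t' ->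
    [/\ Pi t = Pi t', U t = U t', q t = q t' & a t = a t'].

Definition A7 (T1 : set T) : Prop :=
  exists t t', [/\ T1 t, T1 t' & t <> t'].

End Economy.

(* Main.v *)
Require Import Defs.
From HB Require Import structures.
From mathcomp Require Import all_boot all_order all_algebra.
From mathcomp Require Import all_classical all_reals all_analysis.
From mathcomp Require Import measurable_realfun ring lra.
Set Implicit Arguments.
Unset Strict Implicit.
Unset Printing Implicit Defensive.
Import Order.TTheory GRing.Theory Num.Theory.
Import numFieldNormedType.Exports.
Local Open Scope classical_set_scope.
Local Open Scope ring_scope.

(** Suppose [f] is in the weak fine core and a coalition [S] privately blocks it
    in [E^s] through [g].  A small agent is a null set (the measure is complete
    and atomless off [T1]), so one small agent of every type can be added to a
    coalition for free; since all large agents share one information type, a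
    blocking coalition with at least one large agent can then be made to pool
    the information of the whole economy.  Shrinking [g] slightly on most of [S]
    leaves an interior surplus while [g] stays weakly preferred to [f], and
    sharing such a surplus among all members makes every comparison strict and
    feasibility exact.  If [S] contains no large agent, one is added: some large
    agent [t1] weakly prefers the mean of [f] over [T1] to its own bundle, by the
    Jensen inequality (A4), and an approximate Lyapunov argument in [T0] finds
    small agents whose trades offset the cost of serving [t1]. *)

(** * Simple functions *)

Section SimpleFunctions.
Context {d : measure_display} {T : measurableType d} {R : realType}
  {Y : completeNormedModType R}.
Implicit Types (s : seq (set T * Y)) (A B : set T) (y : Y).

(** In a general Banach space the range of an atomless vector integral is convex only up to closure,
    so any redistribution through small agents leaves an error, of norm as small as desired but not
    zero. This is why the slack has to lie in the interior of the cone before a large agent is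
    added: an interior point absorbs such errors, in all of the finitely many states at once. The
    interior point originates in [A5]: the integral of an interior-valued endowment over a set of
    positive measure is interior.

    A large agent has positive mass and cannot join for free. By [A6], serving [t1] with the mean
    costs exactly its share [lam] of the net trade of [f] on [T1]; small agents carrying the same
    share of the net trade of [f] complete this to [lam] times the surplus of [f], which lies in the
    cone. Those small agents may already belong to [S], and moving them from [g] back to [f] gives
    up about the share [lam] of the slack of [g]. [A7] makes [lam < 1], so an interior part remains.

    Sharing the slack respects the information constraint, because the slack is itself a function of
    the state measurable for the pooled information. *)

Definition msimple s := forall p, p \in s -> measurable p.1.

Lemma msimple_cons A y s : msimple ((A, y) :: s) <-> measurable A /\ msimple s.
Proof.
split=> [ms|[mA ms] p].
  split; first by apply: (ms (A, y)); rewrite mem_head.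
  by move=> p ps; apply: ms; rewrite in_cons ps orbT.
by rewrite in_cons => /orP[/eqP->//|/ms].
Qed.

Lemma simple_fun_nil t : simple_fun ([::] : seq (set T * Y)) t = 0 :> Y.
Proof. by rewrite /simple_fun big_nil. Qed.

Lemma simple_fun_cons A y s t :
  simple_fun ((A, y) :: s) t = (if t \in A then y else 0) + simple_fun s t.
Proof.
rewrite /simple_fun big_cons /= indicE.
by case: (t \in A); rewrite ?scale1r ?scale0r.
Qed.

(** Only finitely many values of the second argument occur, so [F t] may be arbitrary in [y], for
    instance built from a choice function. The induction absorbs the value of the head set into [F]
    as a translation. *)
Lemma measurable_simple_comp {d'} {T' : measurableType d'} (F : T -> Y -> T') s :
  msimple s -> (forall y, measurable_fun setT (F ^~ y)) ->
  measurable_fun setT (fun t => F t (simple_fun s t)).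
Proof.
elim: s F => [|[A y] s IH] F.
  move=> _ mF; rewrite (_ : (fun t => _) = F ^~ 0)//.
  by apply/funext => t; rewrite simple_fun_nil.
move=> /msimple_cons[mA ms] mF.
rewrite (_ : (fun t => _) = (fun t => if t \in A then F t (y + simple_fun s t)
    else F t (0 + simple_fun s t))); last first.
  by apply/funext => t; rewrite simple_fun_cons; case: ifP.
apply: measurable_fun_ifT; last 2 first.
- by apply: (IH (fun t x => F t (y + x))) => //.
- by apply: (IH (fun t x => F t (0 + x))) => //.
apply: (measurable_fun_bool true) => //.
rewrite setTI (_ : _ @^-1` _ = A)//.
by apply/seteqP; split=> t /= => [/set_mem|/mem_set].
Qed.

Lemma simple_fun_cat s s' t :
  simple_fun (s ++ s') t = simple_fun s t + simple_fun s' t :> Y.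
Proof. by rewrite /simple_fun big_cat/=. Qed.

Definition simple_scale (c : R) s := [seq (p.1, c *: p.2) | p <- s].

Lemma simple_fun_scale c s t : simple_fun (simple_scale c s) t = c *: simple_fun s t.
Proof.
rewrite /simple_fun big_map scaler_sumr; apply: eq_bigr => p _ /=.
by rewrite !scalerA mulrC.
Qed.

Definition simple_restr A s := [seq (p.1 `&` A, p.2) | p <- s].

Lemma simple_fun_restr A s t :
  simple_fun (simple_restr A s) t = if t \in A then simple_fun s t else 0.
Proof.
rewrite /simple_fun big_map; case: ifPn => tA.
  by apply: eq_bigr => p _ /=; rewrite !indicE in_setI tA andbT.
by apply: big1 => p _ /=; rewrite !indicE in_setI (negbTE tA) andbF scale0r.
Qed.

Lemma msimple_cat s s' : msimple s -> msimple s' -> msimple (s ++ s').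
Proof. by move=> ms ms' p; rewrite mem_cat => /orP[/ms|/ms']. Qed.

Lemma msimple_scale c s : msimple s -> msimple (simple_scale c s).
Proof. by move=> ms _ /mapP[p /ms mp ->]. Qed.

Lemma msimple_restr A s : measurable A -> msimple s -> msimple (simple_restr A s).
Proof. by move=> mA ms _ /mapP[p /ms mp ->]; exact: measurableI. Qed.

Lemma simple_fun_bounded s : exists2 C : R, 0 <= C & forall t, `|simple_fun s t| <= C.
Proof.
exists (\sum_(p <- s) `|p.2|); first exact: sumr_ge0.
move=> t; apply: (le_trans (ler_norm_sum _ _ _)); apply: ler_sum => p _.
rewrite normrZ indicE; case: (_ \in _); rewrite ?normr1 ?normr0 ?mul1r ?mul0r//.
Qed.

Variable mu : {measure set T -> \bar R}.

Lemma simple_int_nil B : simple_int mu B ([::] : seq (set T * Y)) = 0.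
Proof. by rewrite /simple_int big_nil. Qed.

Lemma simple_int_cons B A y s :
  simple_int mu B ((A, y) :: s) = fine (mu (A `&` B)) *: y + simple_int mu B s.
Proof. by rewrite /simple_int big_cons. Qed.

Lemma simple_int_cat B s s' :
  simple_int mu B (s ++ s') = simple_int mu B s + simple_int mu B s'.
Proof. by rewrite /simple_int big_cat/=. Qed.

Lemma simple_int_scale B c s :
  simple_int mu B (simple_scale c s) = c *: simple_int mu B s.
Proof.
rewrite /simple_int big_map scaler_sumr; apply: eq_bigr => p _ /=.
by rewrite !scalerA mulrC.
Qed.

Lemma simple_int_restr B A s :
  simple_int mu B (simple_restr A s) = simple_int mu (A `&` B) s.
Proof. by rewrite /simple_int big_map; apply: eq_bigr => p _ /=; rewrite setIA. Qed.

Hypothesis mufin : (mu setT < +oo)%E.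

Lemma mu_fin A : measurable A -> mu A \is a fin_num.
Proof.
move=> mA; rewrite ge0_fin_numE//; apply: le_lt_trans mufin.
by apply: le_measure; rewrite ?inE.
Qed.

Lemma fine_muU A B : measurable A -> measurable B -> A `&` B = set0 ->
  fine (mu (A `|` B)) = fine (mu A) + fine (mu B).
Proof. by move=> mA mB AB; rewrite measureU// fineD// mu_fin. Qed.

Lemma fine_muID A B : measurable A -> measurable B ->
  fine (mu B) = fine (mu (B `&` A)) + fine (mu (B `\` A)).
Proof.
move=> mA mB; have mBA : measurable (B `&` A) by exact: measurableI.
have mBD : measurable (B `\` A) by exact: measurableD.
rewrite -fine_muU// ?setUIDK//.
by apply/seteqP; split=> // t [[_ At] [_ /(_ At)]].
Qed.

Lemma fine_muE A : measurable A -> (fine (mu A))%:E = mu A.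
Proof. by move=> mA; rewrite fineK// mu_fin. Qed.

Lemma simple_intID A B s : measurable A -> measurable B -> msimple s ->
  simple_int mu B s = simple_int mu (B `&` A) s + simple_int mu (B `\` A) s.
Proof.
move=> mA mB ms; rewrite /simple_int -big_split /=.
apply: eq_big_seq => p /ms mp.
rewrite -scalerDl (@fine_muID A (p.1 `&` B))//; last exact: measurableI.
by rewrite -setIDA -setIA.
Qed.

(* Peeling off one set [A] of [s] splits [B] into [B `&` A], where the offset
   [y] becomes [y + x], and [B `\` A], where it is unchanged: the offset makes
   the induction go through without disjointifying [s]. *)
Lemma simple_int_approx_cone (K : set Y) (pi : Y -> Y) :
  (forall x y, K x -> K y -> K (x + y)) ->
  (forall (c : R) x, 0 <= c -> K x -> K (c *: x)) ->
  (forall x, K (pi x)) ->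
  forall s B y, msimple s -> measurable B ->
  exists2 p, K p &
    (`|fine (mu B) *: y + simple_int mu B s - p|%:E <=
     \int[mu]_(t in B) `|y + simple_fun s t - pi (y + simple_fun s t)|%:E)%E.
Proof.
move=> KD KZ Kpi; elim=> [|[A x] s IH] B y.
  move=> _ mB; exists (fine (mu B) *: pi y); first by apply: KZ; rewrite ?fine_ge0.
  under eq_integral do rewrite simple_fun_nil addr0.
  rewrite simple_int_nil addr0 -scalerBr normrZ ger0_norm ?fine_ge0//.
  by rewrite integral_cst// EFinM fine_muE// muleC.
move=> /msimple_cons[mA ms] mB.
have mBA : measurable (B `&` A) by exact: measurableI.
have mBD : measurable (B `\` A) by exact: measurableD.
have [p1 Kp1 Hp1] := IH (B `&` A) (y + x) ms mBA.
have [p2 Kp2 Hp2] := IH (B `\` A) y ms mBD.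
exists (p1 + p2); first exact: KD.
have -> : fine (mu B) *: y + simple_int mu B ((A, x) :: s) - (p1 + p2) =
  (fine (mu (B `&` A)) *: (y + x) + simple_int mu (B `&` A) s - p1) +
  (fine (mu (B `\` A)) *: y + simple_int mu (B `\` A) s - p2).
  rewrite simple_int_cons (@simple_intID A B)// {1}(@fine_muID A B)// (setIC A).
  rewrite scalerDl scalerDr [RHS]addrACA -opprD; congr (_ - _).
  by rewrite [RHS]addrACA [LHS]addrA; congr (_ + _); exact: addrAC.
apply: (@le_trans _ _ (_%:E + _%:E)%E); first by rewrite -EFinD lee_fin; exact: ler_normD.
have mf : measurable_fun setT (EFin \o (fun t : T => (`|y + simple_fun ((A, x) :: s) t -
    pi (y + simple_fun ((A, x) :: s) t)| : R))).
  apply/measurable_EFinP.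
  have ms' : msimple ((A, x) :: s) by exact/msimple_cons.
  exact: (@measurable_simple_comp _ R (fun=> fun z => `|y + z - pi (y + z)|) _ ms').
rewrite -[in leRHS](setUIDK B A) ge0_integral_setU//; last 2 first.
- by apply: measurable_funS mf.
- by rewrite disj_set2E; apply/eqP/seteqP; split=> // t [[_ At] [_ /(_ At)]].
apply: leeD.
  apply: (le_trans Hp1); rewrite le_eqVlt; apply/orP; left; apply/eqP.
  by apply: eq_integral => t; rewrite inE => -[Bt At]; rewrite simple_fun_cons mem_set// addrA.
apply: (le_trans Hp2); rewrite le_eqVlt; apply/orP; left; apply/eqP.
apply: eq_integral => t; rewrite inE => -[Bt At].
by rewrite simple_fun_cons memNset// add0r.
Qed.

End SimpleFunctions.

(** * Strong measurability *)

Section StronglyMeasurable.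
Context {d : measure_display} {T : measurableType d} {R : realType}
  {Y : completeNormedModType R}.
Variable mu : {measure set T -> \bar R}.
Hypothesis mucomp : measure_is_complete mu.

Lemma measurable_ae_eq (F G : T -> R) : {ae mu, forall t, F t = G t} ->
  measurable_fun setT F -> measurable_fun setT G.
Proof.
move=> FG mF; apply/measurable_EFinP.
apply: (ae_measurable_fun mucomp (f := EFin \o F)); last exact/measurable_EFinP.
by apply: filterS FG => t /= ->.
Qed.

Lemma measurable_ae_cvg (F : nat -> T -> R) (G : T -> R) :
  (forall n, measurable_fun setT (F n)) ->
  {ae mu, forall t, F ^~ t @ \oo --> G t} -> measurable_fun setT G.
Proof.
move=> mF [N [mN N0 FN]].
have mb : measurable_fun setT (fun t => t \in N).
  apply: (measurable_fun_bool true) => //.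
  rewrite setTI (_ : _ @^-1` _ = N)//.
  by apply/seteqP; split=> t /= => [/set_mem|/mem_set].
apply: (@measurable_ae_eq (fun t => if t \in N then 0 else G t)).
  exists N; split=> // t /= h; apply: contrapT => nN; apply: h.
  by rewrite memNset.
apply: (@measurable_fun_cvg _ _ _ _ (fun n t => if t \in N then 0 else F n t)).
  by move=> m; exact: measurable_fun_ifT.
move=> t _; case: ifPn => tN; first exact: cvg_cst.
by apply: contrapT => h; move/negP : tN; apply; rewrite inE; exact: FN.
Qed.

(** Strong measurability: [Y] may be non-separable, so approximability by simple functions is part
    of the notion. *)
Definition smeas (h : T -> Y) := exists s : nat -> seq (set T * Y),
  (forall n, msimple (s n)) /\
  {ae mu, forall t, (fun n => simple_fun (s n) t) @ \oo --> h t}.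

Lemma smeas_ae h h' : {ae mu, forall t, h t = h' t} -> smeas h -> smeas h'.
Proof.
by move=> hh' [s [ms sh]]; exists s; split=> //; apply: filterS2 hh' sh => t ->.
Qed.

Lemma smeas_simple s : msimple s -> smeas (simple_fun s).
Proof. by move=> ms; exists (fun=> s); split=> //; apply: aeW => t; exact: cvg_cst. Qed.

Lemma smeasD h h' : smeas h -> smeas h' -> smeas (fun t => h t + h' t).
Proof.
move=> [s [ms sh]] [s' [ms' sh']]; exists (fun n => s n ++ s' n); split.
  by move=> n; exact: msimple_cat.
apply: filterS2 sh sh' => t st st'.
by under eq_fun do rewrite simple_fun_cat; exact: cvgD.
Qed.

Lemma smeasZ c h : smeas h -> smeas (fun t => c *: h t).
Proof.
move=> [s [ms sh]]; exists (fun n => simple_scale c (s n)); split.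
  by move=> n; exact: msimple_scale.
apply: filterS sh => t st.
by under eq_fun do rewrite simple_fun_scale; exact: cvgZr.
Qed.

Lemma smeasN h : smeas h -> smeas (fun t => - h t).
Proof.
by move=> /(smeasZ (-1)); under [X in smeas X -> _]eq_fun do rewrite scaleN1r.
Qed.

Lemma smeasB h h' : smeas h -> smeas h' -> smeas (fun t => h t - h' t).
Proof. by move=> mh /smeasN; exact: smeasD. Qed.

Definition restr (A : set T) (h : T -> Y) t := if t \in A then h t else 0.

Lemma smeas_restr A h : measurable A -> smeas h -> smeas (restr A h).
Proof.
move=> mA [s [ms sh]]; exists (fun n => simple_restr A (s n)); split.
  by move=> n; exact: msimple_restr.
apply: filterS sh => t st.
under eq_fun do rewrite simple_fun_restr; rewrite /restr.
by case: ifP => _ //; exact: cvg_cst.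
Qed.

(** A nearest point may fail to exist in infinite dimension, but a point within twice the distance
    does. If the distance is positive, it serves as its own tolerance in the infimum; if it is zero,
    closedness puts [x] itself in [D]. *)
Lemma near_projection (D : set Y) : closed D -> D !=set0 ->
  exists pi : Y -> Y, forall x, D (pi x) /\
    forall y, D y -> `|x - pi x| <= 2 * `|x - y|.
Proof.
move=> cD [y0 Dy0].
suff h x : exists z, D z /\ forall y, D y -> `|x - z| <= 2 * `|x - y|.
  by exists (fun x => sval (cid (h x))) => x; exact: svalP (cid (h x)).
pose E := [set `|x - y| | y in D].
have E0 : lbound E 0 by move=> _ [y _ <-].
have hE : has_inf E by split; [exists `|x - y0|, y0|exists 0].
have infE y : D y -> inf E <= `|x - y|.
  by move=> Dy; apply: ge_inf; [exists 0|exists y].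
have := lb_le_inf (proj1 hE) E0; rewrite le_eqVlt => /orP[/eqP i0|i0].
  exists x; split; last by move=> y _; rewrite subrr normr0 mulr_ge0.
  apply: contrapT => nDx.
  have /nbhs_ballP[e /= e0 he] : nbhs x (~` D).
    by apply: open_nbhs_nbhs; split=> //; exact: closed_openC.
  have [_ [z Dz <-]] := inf_adherent e0 hE; rewrite -i0 add0r => xz.
  by apply: (he z) => //; rewrite -ball_normE.
have [_ [z Dz <-] xz] := inf_adherent i0 hE.
exists z; split=> // y /infE xy; apply: (le_trans (ltW xz)); lra.
Qed.

Lemma within_continuous_cvg (D : set Y) (f : Y -> R) (u : nat -> Y) x :
  {within D, continuous f} -> D x -> (forall n, D (u n)) -> u @ \oo --> x ->
  f (u n) @[n --> \oo] --> f x.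
Proof.
move=> /subspace_continuousP cf Dx Du ux.
apply: (@cvg_comp _ _ _ u f _ (within D (nbhs x))); last exact: cf.
move=> B WB; have uB : \forall n \near \oo, D (u n) -> B (u n) by exact: (ux _ WB).
by apply: (@filterS _ \oo _ _ (u @^-1` B) _ uB) => n; exact.
Qed.

(** Simple approximants of [h] may leave [D], where [F t] is not known to be continuous. The near
    projection brings them back, and [pi (s t)] stays within three times the distance from [s t] to
    [h t], so convergence survives. *)
Lemma smeas_comp (D : set Y) (F : T -> Y -> R) h :
  closed D -> smeas h -> (forall t, D (h t)) ->
  (forall y, D y -> measurable_fun setT (F ^~ y)) ->
  (forall t, {within D, continuous (F t)}) ->
  measurable_fun setT (fun t => F t (h t)).
Proof.
move=> cD [s [ms sh]] Dh mF cF.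
have [[t0]|T0] := pselect (exists t0 : T, True); last first.
  move=> _ B mB; rewrite setTI (_ : _ @^-1` _ = set0)//.
  by apply/seteqP; split=> // t; exfalso; apply: T0; exists t.
move=> _; have [|pi Hpi] := near_projection cD; first by exists (h t0).
have Dpi x : D (pi x) by case: (Hpi x).
apply: (@measurable_ae_cvg (fun n t => F t (pi (simple_fun (s n) t)))).
  move=> n; apply: (@measurable_simple_comp _ _ _ _ _ R (fun t z => F t (pi z)) _ (ms n)).
  by move=> y; exact: mF.
apply: filterS sh => t st.
apply: within_continuous_cvg (cF t) (Dh t) _ _ => //.
apply/cvgrPdist_lt => e e0.
have /cvgrPdist_lt /(_ (e / 3)) := st; rewrite divr_gt0// => /(_ isT).
apply: filterS => n hn.
rewrite -(subrK (simple_fun (s n) t) (h t)) -addrA.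
apply: (le_lt_trans (ler_normD _ _)).
have [_ /(_ _ (Dh t))] := Hpi (simple_fun (s n) t).
rewrite (distrC _ (h t)); move: hn; lra.
Qed.

Lemma smeas_norm h : smeas h -> measurable_fun setT (EFin \o (fun t => `|h t| : R)).
Proof.
move=> mh; apply/measurable_EFinP.
apply: (@smeas_comp setT (fun=> fun y => `|y|) _ closedT mh) => //.
by move=> t; apply: continuous_subspaceT => y; exact: norm_continuous.
Qed.

End StronglyMeasurable.

(** * The Bochner integral *)

Section BochnerIntegral.
Context {d : measure_display} {T : measurableType d} {R : realType}
  {Y : completeNormedModType R}.
Variable mu : {measure set T -> \bar R}.
Hypothesis mucomp : measure_is_complete mu.
Hypothesis mufin : (mu setT < +oo)%E.
Implicit Types (h k : T -> Y) (s : seq (set T * Y)) (v : Y).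

Definition L1norm h : \bar R := (\int[mu]_t (`|h t|)%:E)%E.

Lemma L1norm_ge0 h : (0 <= L1norm h)%E.
Proof. by apply: integral_ge0 => t _; rewrite lee_fin. Qed.

Lemma le_L1norm h k : smeas mu h -> smeas mu k ->
  (forall t, `|h t| <= `|k t|) -> (L1norm h <= L1norm k)%E.
Proof.
move=> mh mk hk; apply: ge0_le_integral => //.
- exact: (smeas_norm mucomp).
- exact: (smeas_norm mucomp).
- by move=> t _; rewrite lee_fin.
Qed.

Lemma eq_L1norm h k : (forall t, `|h t| = `|k t|) -> L1norm h = L1norm k.
Proof. by move=> hk; apply: eq_integral => t _; rewrite hk. Qed.

Lemma ae_eq_L1norm h k : smeas mu h -> smeas mu k ->
  {ae mu, forall t, h t = k t} -> L1norm h = L1norm k.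
Proof.
move=> mh mk hk; apply: ae_eq_integral => //; [exact: (smeas_norm mucomp)|exact: (smeas_norm mucomp)|].
by apply: filterS hk => t /= ->.
Qed.

Lemma L1normD h k : smeas mu h -> smeas mu k ->
  (L1norm (fun t => h t + k t)%R <= L1norm h + L1norm k)%E.
Proof.
move=> mh mk; rewrite /L1norm -ge0_integralD//; last 2 first.
- exact: (smeas_norm mucomp).
- exact: (smeas_norm mucomp).
apply: ge0_le_integral => //.
- by apply: (smeas_norm mucomp) => //; exact: smeasD.
- by apply: emeasurable_funD; exact: (smeas_norm mucomp).
- by move=> t _; rewrite -EFinD lee_fin; exact: ler_normD.
Qed.

Lemma L1norm_distC h k : L1norm (fun t => h t - k t)%R = L1norm (fun t => k t - h t)%R.
Proof. by apply: eq_L1norm => t; rewrite distrC. Qed.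

Lemma L1norm_distD l h k : smeas mu h -> smeas mu k -> smeas mu l ->
  (L1norm (fun t => h t - k t)%R <=
   L1norm (fun t => h t - l t)%R + L1norm (fun t => l t - k t)%R)%E.
Proof.
move=> mh mk ml.
rewrite (@eq_L1norm _ (fun t => (h t - l t) + (l t - k t))); last first.
  by move=> t; rewrite addrA subrK.
by apply: L1normD; exact: smeasB.
Qed.

Lemma L1normZ c h : smeas mu h -> L1norm (fun t => c *: h t)%R = (`|c|%:E * L1norm h)%E.
Proof.
move=> mh; rewrite /L1norm -ge0_integralZl//; last exact: (smeas_norm mucomp).
by apply: eq_integral => t _; rewrite normrZ EFinM.
Qed.

Lemma L1norm_restr A h : measurable A -> smeas mu h -> (L1norm (restr A h) <= L1norm h)%E.
Proof.
move=> mA mh; apply: le_L1norm => //; first exact: smeas_restr.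
by move=> t; rewrite /restr; case: ifP; rewrite ?normr0.
Qed.

(** The trivial cone [{0}], with the zero map for [pi], turns the estimate of the distance to a cone
    into the triangle inequality for integrals. *)
Lemma simple_int_le s : msimple s ->
  (`|simple_int mu setT s|%:E <= L1norm (simple_fun s))%E.
Proof.
move=> ms.
have [|||p -> ] := @simple_int_approx_cone _ _ _ Y mu mufin [set 0] (fun=> 0) _ _ _ s setT 0 ms measurableT.
- by move=> x y -> ->; rewrite addr0.
- by move=> c x _ ->; rewrite scaler0.
- by [].
rewrite scaler0 add0r subr0 => /le_trans; apply.
rewrite le_eqVlt; apply/orP; left; apply/eqP; apply: eq_L1norm => t.
by rewrite subr0 add0r.
Qed.

Lemma simple_int_dist s s' : msimple s -> msimple s' ->
  (`|simple_int mu setT s - simple_int mu setT s'|%:E <=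
   L1norm (fun t => simple_fun s t - simple_fun s' t)%R)%E.
Proof.
move=> ms ms'.
have ms2 : msimple (s ++ simple_scale (-1) s').
  by apply: msimple_cat => //; exact: msimple_scale.
have := simple_int_le ms2.
rewrite simple_int_cat simple_int_scale scaleN1r => /le_trans; apply.
rewrite le_eqVlt; apply/orP; left; apply/eqP; apply: eq_L1norm => t.
by rewrite simple_fun_cat simple_fun_scale scaleN1r.
Qed.

(** The Bochner integral over the whole space in epsilon form: one simple function close to [h] in
    mean whose integral is close to [v]. Integrals over [S] are those of [restr S h];
    [is_bochner_int_has] and [has_is_bochner_int] pass from approximating sequences to this form and
    back. *)
Definition has_bochner h v := smeas mu h /\ forall e : R, 0 < e ->
  exists s, [/\ msimple s, (L1norm (fun t => h t - simple_fun s t)%R <= e%:E)%E &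
    `|simple_int mu setT s - v| <= e].

Lemma has_bochner_smeas h v : has_bochner h v -> smeas mu h.
Proof. by case. Qed.

Lemma has_bochner_dist h v s : has_bochner h v -> msimple s ->
  (`|v - simple_int mu setT s|%:E <= L1norm (fun t => h t - simple_fun s t)%R)%E.
Proof.
move=> [mh hv] ms; apply/lee_addgt0Pr => e e0.
have [|s' [ms' hs' vs']] := hv (e / 2); first by rewrite divr_gt0.
have mS := smeas_simple mu ms; have mS' := smeas_simple mu ms'.
apply: (@le_trans _ _ ((e / 2)%:E + `|simple_int mu setT s' - simple_int mu setT s|%:E)%E).
  rewrite -EFinD lee_fin -(subrKA (simple_int mu setT s')).
  by apply: (le_trans (ler_normD _ _)); rewrite lerD2r distrC.
rewrite addeC [in leRHS](splitr e) EFinD addeA; apply: leeD => //.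
apply: (le_trans (simple_int_dist ms' ms)).
apply: (le_trans (L1norm_distD mS' mS mh)).
by rewrite addeC; apply: leeD => //; rewrite L1norm_distC.
Qed.

Lemma has_bochner_unique h v v' : has_bochner h v -> has_bochner h v' -> v = v'.
Proof.
move=> hv hv'; apply/eqP; rewrite -subr_eq0 -normr_le0; apply/ler_addgt0Pr => e e0.
have [|s [ms hs vs]] := hv.2 (e / 2); first by rewrite divr_gt0.
rewrite add0r -(subrKA (simple_int mu setT s)) (splitr e).
apply: (le_trans (ler_normD _ _)); apply: lerD; first by rewrite distrC.
by rewrite distrC -lee_fin; apply: (le_trans (has_bochner_dist hv' ms)).
Qed.

Lemma has_bochner_ae h h' v : {ae mu, forall t, h t = h' t} ->
  has_bochner h v -> has_bochner h' v.
Proof.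
move=> hh' [mh hv]; have mh' := smeas_ae hh' mh; split=> // e /hv[s [ms hs vs]].
exists s; split=> //; rewrite -(@ae_eq_L1norm (fun t => h t - simple_fun s t)%R)//.
- by apply: smeasB => //; exact: smeas_simple.
- by apply: smeasB => //; exact: smeas_simple.
- by apply: filterS hh' => t ->.
Qed.

Lemma has_bochnerD h h' v v' : has_bochner h v -> has_bochner h' v' ->
  has_bochner (fun t => h t + h' t) (v + v').
Proof.
move=> [mh hv] [mh' hv']; split; first exact: smeasD.
move=> e e0; have e20 : 0 < e / 2 by rewrite divr_gt0.
have [s [ms hs vs]] := hv _ e20; have [s' [ms' hs' vs']] := hv' _ e20.
exists (s ++ s'); split; first exact: msimple_cat.
  rewrite (@eq_L1norm _ (fun t => (h t - simple_fun s t) + (h' t - simple_fun s' t))).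
    rewrite (splitr e) EFinD; apply: le_trans (L1normD _ _) (leeD hs hs').
      by apply: smeasB => //; exact: smeas_simple.
    by apply: smeasB => //; exact: smeas_simple.
  by move=> t; rewrite simple_fun_cat opprD addrACA.
rewrite simple_int_cat opprD addrACA (splitr e).
exact: le_trans (ler_normD _ _) (lerD vs vs').
Qed.

Lemma has_bochnerZ c h v : has_bochner h v -> has_bochner (fun t => c *: h t) (c *: v).
Proof.
move=> [mh hv]; split; first exact: smeasZ.
move=> e e0; have c0 : 0 < `|c| + 1 by rewrite ltr_pwDr.
have [|s [ms hs vs]] := hv (e / (`|c| + 1)); first by rewrite divr_gt0.
have ce : `|c| * (e / (`|c| + 1)) <= e.
  by rewrite mulrCA ger_pMr// ler_pdivrMr// mul1r lerDl.
exists (simple_scale c s); split; first exact: msimple_scale.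
  rewrite (@eq_L1norm _ (fun t => c *: (h t - simple_fun s t))); last first.
    by move=> t; rewrite simple_fun_scale scalerBr.
  rewrite L1normZ; last by apply: smeasB => //; exact: smeas_simple.
  apply: (@le_trans _ _ (`|c|%:E * (e / (`|c| + 1))%:E)%E); last by rewrite -EFinM lee_fin.
  by apply: lee_pmul => //; exact: L1norm_ge0.
rewrite simple_int_scale -scalerBr normrZ; apply: le_trans ce.
by apply: ler_wpM2l.
Qed.

Lemma has_bochnerB h h' v v' : has_bochner h v -> has_bochner h' v' ->
  has_bochner (fun t => h t - h' t) (v - v').
Proof.
move=> hv /(has_bochnerZ (-1)) hv'; have := has_bochnerD hv hv'.
by under [X in has_bochner X]eq_fun do rewrite scaleN1r; rewrite scaleN1r.
Qed.

Lemma has_bochner_restr_cst A y : measurable A ->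
  has_bochner (restr A (fun=> y)) (fine (mu A) *: y).
Proof.
move=> mA; have ms : msimple [:: (A, y)] by apply/msimple_cons; split.
have E t : restr A (fun=> y) t = simple_fun [:: (A, y)] t.
  by rewrite simple_fun_cons simple_fun_nil addr0.
split; first by rewrite (funext E); exact: smeas_simple.
move=> e e0; exists [:: (A, y)]; split=> //.
  rewrite (@eq_L1norm _ (fun=> 0)); last by move=> t; rewrite E subrr.
  by rewrite /L1norm normr0 integral0 lee_fin ltW.
by rewrite simple_int_cons simple_int_nil setIT addr0 subrr normr0 ltW.
Qed.

(** Closeness in mean makes the integrals of the approximants a Cauchy sequence, and [Y] is
    complete. *)
Lemma has_bochner_exists h : smeas mu h ->
  (forall e : R, 0 < e -> exists2 s, msimple s &
    (L1norm (fun t => h t - simple_fun s t)%R <= e%:E)%E) ->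
  exists v, has_bochner h v.
Proof.
move=> mh hs.
have H n : exists s, msimple s /\ (L1norm (fun t => h t - simple_fun s t)%R <= (n.+1%:R^-1)%:E)%E.
  by have [|s ms s1] := hs (n.+1%:R^-1); [rewrite invr_gt0|exists s].
pose s n := sval (cid (H n)).
have ms n : msimple (s n) by have [] := svalP (cid (H n)).
have sn n : (L1norm (fun t => h t - simple_fun (s n) t)%R <= (n.+1%:R^-1)%:E)%E.
  by have [] := svalP (cid (H n)).
have D n m : `|simple_int mu setT (s n) - simple_int mu setT (s m)| <= n.+1%:R^-1 + m.+1%:R^-1.
  rewrite -lee_fin; apply: (le_trans (simple_int_dist (ms n) (ms m))).
  rewrite EFinD; apply: le_trans (L1norm_distD _ _ mh) _; [exact: smeas_simple|exact: smeas_simple|].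
  by apply: leeD => //; rewrite L1norm_distC.
have : cvg ((fun n => simple_int mu setT (s n)) @ \oo).
  apply/cauchy_cvgP/cauchy_exP => e e0.
  have e20 : 0 < e / 2 by rewrite divr_gt0.
  have [N _ HN] := near_infty_natSinv_lt (PosNum e20).
  exists (simple_int mu setT (s N)); exists N => // n /= Nn.
  rewrite -ball_normE /=; apply: (le_lt_trans (D _ _)).
  by rewrite [ltRHS]splitr; apply: ltrD; apply: HN => /=.
move=> /cvg_ex[v sv]; exists v; split=> // e e0.
have [N _ HN] := near_infty_natSinv_lt (PosNum e0).
have /cvgrPdist_le /(_ e e0)[M _ HM] := sv.
exists (s (maxn N M)); split => //.
  apply: (le_trans (sn _)); rewrite lee_fin ltW//; apply: HN => /=; exact: leq_maxl.
by rewrite distrC; apply: HM => /=; exact: leq_maxr.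
Qed.

Lemma has_bochner_restr A h v : measurable A -> has_bochner h v ->
  exists v', has_bochner (restr A h) v'.
Proof.
move=> mA [mh hv]; apply: has_bochner_exists; first exact: smeas_restr.
move=> e /hv[s [ms hs _]]; exists (simple_restr A s); first exact: msimple_restr.
apply: le_trans hs.
rewrite (@eq_L1norm _ (restr A (fun t => h t - simple_fun s t))); last first.
  by move=> t; rewrite /restr simple_fun_restr; case: ifP; rewrite ?subrr.
by apply: L1norm_restr => //; apply: smeasB => //; exact: smeas_simple.
Qed.

Lemma has_bochner_restr_dist A h v s : measurable A -> smeas mu h ->
  has_bochner (restr A h) v -> msimple s ->
  (`|v - simple_int mu A s|%:E <= L1norm (fun t => h t - simple_fun s t)%R)%E.
Proof.
move=> mA mh hv ms; rewrite -(setIT A) -simple_int_restr.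
apply: (le_trans (has_bochner_dist hv (msimple_restr mA ms))).
rewrite (@eq_L1norm _ (restr A (fun t => h t - simple_fun s t))); last first.
  by move=> t; rewrite /restr simple_fun_restr; case: ifP; rewrite ?subrr.
by apply: L1norm_restr => //; apply: smeasB => //; exact: smeas_simple.
Qed.

(** If a ball of radius [e] around [v] missed [K], take a simple [s] within [e / 4]. Projecting [s]
    onto [K] costs at most twice its distance to [h], since [h] takes values in [K]. The integral of
    [s] is then within [e / 2] of [K], and [v] within [3 e / 4]. *)
Lemma has_bochner_cone (K : set Y) h v : closed K -> K 0 ->
  (forall x y, K x -> K y -> K (x + y)) ->
  (forall (c : R) x, 0 <= c -> K x -> K (c *: x)) ->
  (forall t, K (h t)) -> has_bochner h v -> K v.
Proof.
move=> cK K0 KD KZ Kh hv.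
have [|pi Hpi] := near_projection cK; first by exists 0.
have Kpi x : K (pi x) by case: (Hpi x).
apply: contrapT => nKv.
have /nbhs_ballP[e /= e0 he] : nbhs v (~` K).
  by apply: open_nbhs_nbhs; split=> //; exact: closed_openC.
have e40 : 0 < e / 4 by rewrite divr_gt0.
have [s [ms hs vs]] := hv.2 _ e40.
have [p Kp] := simple_int_approx_cone mufin KD KZ Kpi 0 ms measurableT.
rewrite scaler0 add0r => pd.
apply: (he p) => //; rewrite -ball_normE /=.
rewrite -(subrKA (simple_int mu setT s)).
apply: (le_lt_trans (ler_normD _ _)).
suff : `|simple_int mu setT s - p| <= 2 * (e / 4).
  by move: vs; rewrite distrC; lra.
rewrite -lee_fin; apply: (le_trans pd).
apply: (@le_trans _ _ (2%:E * L1norm (fun t => h t - simple_fun s t)%R)%E); last first.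
  by rewrite EFinM; apply: lee_pmul => //; exact: L1norm_ge0.
have mB : smeas mu (fun t => h t - simple_fun s t).
  by apply: smeasB; [exact: has_bochner_smeas hv|exact: smeas_simple].
rewrite /L1norm -ge0_integralZl//; last exact: (smeas_norm mucomp).
apply: ge0_le_integral => //.
- apply/measurable_EFinP.
  exact: (@measurable_simple_comp _ _ _ _ _ R (fun=> fun z => `|0 + z - pi (0 + z)|) _ ms).
- by apply: measurable_funeM; exact: (smeas_norm mucomp).
move=> t _; rewrite add0r -EFinM lee_fin (distrC (h t)).
exact: (Hpi _).2.
Qed.

Lemma restrI A B h : restr A (restr B h) = restr (A `&` B) h.
Proof.
by apply/funext => t; rewrite /restr in_setI; case: (t \in A); case: (t \in B).
Qed.

Lemma restrT h : restr setT h = h.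
Proof. by apply/funext => t; rewrite /restr in_setT. Qed.

(** Convergence in mean yields almost everywhere convergence along chosen indices: errors bounded by
    [1 / 2 ^ n.+1] are summable, so their series is finite almost everywhere and its terms tend to
    0. The indices need not increase. *)
Lemma L1_smeas h (s : nat -> seq (set T * Y)) : (forall n, msimple (s n)) ->
  (forall n, measurable_fun setT (fun t => `|h t - simple_fun (s n) t|)) ->
  (forall e : R, 0 < e -> exists n, (L1norm (fun t => h t - simple_fun (s n) t)%R <= e%:E)%E) ->
  smeas mu h.
Proof.
move=> ms md hs.
have H n : exists i : nat, (L1norm (fun t => h t - simple_fun (s i) t)%R <= (1 / (2 ^ n.+1)%:R)%:E)%E.
  by apply: hs; rewrite divr_gt0// ltr0n expn_gt0.
pose j n := sval (cid (H n)).
have jn n : (L1norm (fun t => h t - simple_fun (s (j n)) t)%R <= (1 / (2 ^ n.+1)%:R)%:E)%E.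
  exact: (svalP (cid (H n))).
exists (s \o j); split; first by move=> n /=.
pose g n t : \bar R := (`|h t - simple_fun (s (j n)) t|)%:E.
have mg n : measurable_fun setT (g n) by apply/measurable_EFinP.
have g0 n t : (0 <= g n t)%E by rewrite lee_fin.
have Ifin : (\int[mu]_t (\sum_(n <oo) g n t) < +oo)%E.
  rewrite integral_nneseries//.
  apply: (@le_lt_trans _ _ (\sum_(i <oo) (1 / (2 ^ i.+1)%:R)%:E)%E).
    apply: lee_nneseries => [n _ _|n _ /=]; first by apply: integral_ge0 => t _; exact: g0.
    exact: jn.
  by apply: le_lt_trans (epsilon_trick0 _ _) _ => //; exact: ltry.
have G0 t : (0 <= \sum_(n <oo) g n t)%E by exact: nneseries_ge0.
have : {ae mu, forall t, setT t -> (\sum_(n <oo) g n t)%E \is a fin_num}.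
  apply: integrable_ae => //; apply/integrableP; split.
    exact: ge0_emeasurable_sum.
  by under eq_integral do rewrite gee0_abs//.
apply: filterS => t /(_ Logic.I) fint.
have tail := nneseries_tail_cvg (P := xpredT) (f := g ^~ t).
have {tail} : (\sum_(N <= i <oo) g i t)%E @[N --> \oo] --> 0%E.
  by apply: tail => //; rewrite -ge0_fin_numE.
move=> tail; have gt : g ^~ t @ \oo --> 0%E.
  apply: (squeeze_cvge _ (cvg_cst 0%E) tail).
  apply: nearW => n; rewrite g0 /=.
  have := @nneseries_lim_ge R (g ^~ t) xpredT n n.+1.
  by rewrite big_nat1; apply => i _ _.
apply/cvgrPdist_lt => e e0.
have := gt; rewrite /g => /fine_cvgP[_ /cvgrPdist_lt/(_ e e0)].
by apply: filterS => n /=; rewrite sub0r normrN normr_id.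
Qed.

End BochnerIntegral.

(** * Integrals over subsets *)

Section BochnerIntegralOnSets.
Context {d : measure_display} {T : measurableType d} {R : realType}
  {Y : completeNormedModType R}.
Variable mu : {measure set T -> \bar R}.
Hypothesis mucomp : measure_is_complete mu.
Hypothesis mufin : (mu setT < +oo)%E.
Implicit Types (h : T -> Y) (s : seq (set T * Y)) (v : Y) (A B S : set T).

Lemma restr_simpleB S h s :
  (fun t => `|restr S h t - simple_fun (simple_restr S s) t| : R) =
  (fun t => `|h t - simple_fun s t|) \_ S.
Proof.
apply/funext => t; rewrite /restr simple_fun_restr patchE.
by case: ifP => // _; rewrite subrr normr0.
Qed.

Lemma L1norm_restr_simple S h s :
  L1norm mu (fun t => restr S h t - simple_fun (simple_restr S s) t) =
  (\int[mu]_(t in S) (`|h t - simple_fun s t|)%:E)%E.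
Proof.
rewrite [RHS]integral_mkcond; apply: eq_integral => t _.
have /(congr1 (fun g => g t)) -> := restr_simpleB S h s.
by rewrite !patchE; case: ifP.
Qed.

Lemma is_bochner_int_has S h v : measurable S ->
  is_bochner_int mu S h v -> has_bochner mu (restr S h) v.
Proof.
move=> mS [s [ms md hs sv]].
have ms' n : msimple (s n) by move=> p ps; have /allP/(_ _ ps)/asboolP := ms n.
have msr n : msimple (simple_restr S (s n)) by exact: msimple_restr.
have small (e : R) : 0 < e -> \forall n \near \oo,
    (L1norm mu (fun t => restr S h t - simple_fun (simple_restr S (s n)) t)%R <= e%:E)%E.
  move=> e0; move/fine_cvgP : hs => [hfin /cvgrPdist_le /(_ e e0)].
  apply: filterS2 hfin => n nfin; rewrite /= sub0r normrN => hn.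
  rewrite L1norm_restr_simple -(fineK nfin) lee_fin.
  by apply: le_trans hn; rewrite ler_norm.
split.
  apply: (L1_smeas msr) => [n|e /small[n _ /(_ n (leqnn n))]]; last by exists n.
  by rewrite restr_simpleB; apply: (measurable_restrictT _ mS).1; exact: md.
move=> e e0; have := small e e0; have /cvgrPdist_le /(_ e e0) := sv.
move=> /filterI/[apply] -[n _ /(_ n (leqnn n))] [/= h1 h2].
exists (simple_restr S (s n)); split=> //.
by rewrite simple_int_restr setIT distrC.
Qed.

Lemma has_is_bochner_int S h v : measurable S ->
  has_bochner mu (restr S h) v -> is_bochner_int mu S h v.
Proof.
move=> mS hv.
have H n : exists s, [/\ msimple s,
    (L1norm mu (fun t => restr S h t - simple_fun (simple_restr S s) t)%R <= (n.+1%:R^-1)%:E)%E &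
    `|v - simple_int mu S s| <= n.+1%:R^-1].
  have [|s [ms hs _]] := hv.2 (n.+1%:R^-1); first by rewrite invr_gt0.
  have hs' : (L1norm mu (fun t => restr S h t - simple_fun (simple_restr S s) t)%R <= (n.+1%:R^-1)%:E)%E.
    apply: le_trans hs.
    rewrite (@eq_L1norm _ _ _ _ _ _ (restr S (fun t => restr S h t - simple_fun s t))); last first.
      by move=> t; rewrite /restr simple_fun_restr; case: ifP; rewrite ?subrr.
    by apply: L1norm_restr => //; apply: smeasB; [exact: hv.1|exact: smeas_simple].
  exists s; split=> //; rewrite -lee_fin; apply: le_trans hs'.
  rewrite -[in leLHS](setIT S) -simple_int_restr.
  by apply: has_bochner_dist => //; exact: msimple_restr.
pose s n := sval (cid (H n)).
have inv0 : (fun n => n.+1%:R^-1 : R) @ \oo --> 0.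
  apply/cvgrPdist_lt => e e0; have := near_infty_natSinv_lt (PosNum e0).
  by apply: filterS => n; rewrite sub0r normrN ger0_norm.
exists s; split.
- move=> n; apply/allP => p ps; apply/asboolP.
  by have [ms _ _] := svalP (cid (H n)); exact: ms.
- move=> n; have [ms _ _] := svalP (cid (H n)).
  apply: (measurable_restrictT _ mS).2.
  rewrite -restr_simpleB; apply/measurable_EFinP.
  have mB : smeas mu (fun t => restr S h t - simple_fun (simple_restr S (s n)) t).
    by apply: smeasB; [exact: hv.1|apply: smeas_simple; exact: msimple_restr].
  exact: smeas_norm mB.
- have inv0E : (fun n => (n.+1%:R^-1 : R)%:E) @ \oo --> 0%E.
    by apply/fine_cvgP; split; [exact: nearW|exact: inv0].
  apply: (squeeze_cvge _ (cvg_cst 0%E) inv0E).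
  apply: nearW => n; have [ms sn _] := svalP (cid (H n)).
  rewrite -L1norm_restr_simple sn andbT; exact: L1norm_ge0.
- apply/cvgrPdist_le => e e0; have /cvgrPdist_le/(_ e e0) := inv0.
  apply: filterS => n; rewrite sub0r normrN ger0_norm// => /(le_trans _); apply.
  by have [] := svalP (cid (H n)).
Qed.

Lemma has_bochner_bint S h : measurable S -> bochner_integrable mu S h ->
  has_bochner mu (restr S h) (bint mu S h).
Proof.
move=> mS [v hv]; apply: is_bochner_int_has => //.
exact: (@xgetPex _ 0 [set v | is_bochner_int mu S h v] (ex_intro _ v hv)).
Qed.

Lemma bint_eq S h v : measurable S -> has_bochner mu (restr S h) v ->
  bochner_integrable mu S h /\ bint mu S h = v.
Proof.
move=> mS hv; have bi : bochner_integrable mu S h.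
  by exists v; exact: has_is_bochner_int.
by split=> //; apply: (has_bochner_unique mucomp mufin _ hv); exact: has_bochner_bint.
Qed.

(** Replacing [h] by a simple function bounded by [C] costs [e / 2], and the simple function
    contributes at most [C] times the measure of [A]. The constant [C + 1] keeps the denominator
    positive. *)
Lemma has_bochner_abs_cont h v (e : R) : has_bochner mu h v -> 0 < e ->
  exists2 del : R, 0 < del & forall A w, measurable A -> fine (mu A) < del ->
    has_bochner mu (restr A h) w -> `|w| <= e.
Proof.
move=> [mh hv] e0; have e20 : 0 < e / 2 by rewrite divr_gt0.
have [s [ms hs _]] := hv _ e20.
have [C C0 sC] := simple_fun_bounded s.
exists (e / 2 / (C + 1)); first by rewrite divr_gt0// ltr_wpDl.
move=> A w mA Adel hw.
rewrite -(subrK (simple_int mu A s) w) (splitr e).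
apply: (le_trans (ler_normD _ _)); apply: lerD.
  by rewrite -lee_fin; apply: le_trans hs; exact: has_bochner_restr_dist hw ms.
apply: (@le_trans _ _ ((C + 1) * fine (mu A))); last first.
  by move: Adel; rewrite ltr_pdivlMr ?ltr_wpDl// mulrC => /ltW.
rewrite -lee_fin -(setIT A) -simple_int_restr.
apply: (le_trans (simple_int_le mufin (msimple_restr mA ms))).
rewrite setIT EFinM fine_muE// -integral_cst// [leRHS]integral_mkcond.
apply: ge0_le_integral => //.
- exact: (smeas_norm mucomp (smeas_simple mu (msimple_restr mA ms))).
- by apply: (measurable_restrictT _ mA).1; exact: measurable_cst.
move=> t _; rewrite simple_fun_restr patchE; case: ifP => _; last by rewrite normr0.
by rewrite lee_fin; apply: (le_trans (sC t)); rewrite lerDl.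
Qed.

Lemma interiorP (K : set Y) x :
  interior K x <-> exists2 r : R, 0 < r & forall y, `|x - y| < r -> K y.
Proof.
split=> [/nbhs_ballP[r /= r0 rK]|[r r0 rK]].
  by exists r => // y xy; apply: rK; rewrite -ball_normE.
by apply/nbhs_ballP; exists r => // y; rewrite -ball_normE => /rK.
Qed.

Lemma interiorD (K : set Y) x y : (forall x y, K x -> K y -> K (x + y)) ->
  K x -> interior K y -> interior K (x + y).
Proof.
move=> KD Kx /interiorP[r r0 rK]; apply/interiorP; exists r => // z xyz.
rewrite -(subrK x z) addrC; apply: KD => //; apply: rK.
by rewrite opprB addrA (addrC y).
Qed.

Lemma interiorZ (K : set Y) (c : R) x : (forall (c : R) x, 0 <= c -> K x -> K (c *: x)) ->
  0 < c -> interior K x -> interior K (c *: x).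
Proof.
move=> KZ c0 /interiorP[r r0 rK]; apply/interiorP; exists (c * r); first by rewrite mulr_gt0.
move=> z xz; rewrite -(scalerKV (lt0r_neq0 c0) z); apply: KZ; first exact: ltW.
apply: rK; rewrite -(ltr_pM2l c0); apply: le_lt_trans xz.
by rewrite -{1}(gtr0_norm c0) -normrZ scalerBr scalerKV// lt0r_neq0.
Qed.

(** The sets [B n k] are measurable because [P k] is tested only on values of a simple function. If
    the ball of radius [r] around [h t] lies in [K], then [t] lies in some [B n k] as soon as
    [3 / k.+1 < r] and [s n] is close to [h] at [t]. Countably many of these sets thus cover [S] up
    to a null set, and one of them has positive measure. The factor 2 in [P] leaves a radius
    [1 / k.+1] around [h t] itself. *)
Lemma uniform_interior (K : set Y) S h : measurable S -> (0 < mu S)%E ->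
  smeas mu (restr S h) -> (forall t, S t -> interior K (h t)) ->
  exists A (r : R), [/\ measurable A, A `<=` S, (0 < mu A)%E, 0 < r &
    forall t y, A t -> `|h t - y| < r -> K y].
Proof.
move=> mS S0 mh Kh; have [s [ms sh]] := mh.
pose P (k : nat) (x : Y) := forall y, `|x - y| < 2 * k.+1%:R^-1 -> K y.
pose B n k := S `&` ([set t | `|restr S h t - simple_fun (s n) t| < k.+1%:R^-1] `&`
   [set t | P k (simple_fun (s n) t)]).
have mB n k : measurable (B n k).
  apply: measurableI => //; apply: measurableI.
    have := smeas_norm mucomp (smeasB mh (smeas_simple mu (ms n))).
    move=> /measurable_EFinP mn; rewrite -[X in measurable X]setTI.
    have := measurable_fun_ltr mn (measurable_cst (k.+1%:R^-1 : R)).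
    by move=> /(_ measurableT [set true]); apply.
  have mP : measurable_fun setT (fun t => `[< P k (simple_fun (s n) t) >]).
    exact: (@measurable_simple_comp _ _ _ _ _ _ (fun=> fun x => `[< P k x >]) _ (ms n)).
  have := mP measurableT [set true] I; rewrite setTI; congr measurable.
  by apply/seteqP; split=> t /= /asboolP.
have [[n [k Bnk]]|B0] := pselect (exists n k, (0 < mu (B n k))%E).
  exists (B n k), (k.+1%:R^-1); split=> //.
    by move=> t [].
  move=> t y [St [/= h1 h2]] hy; apply: h2.
  rewrite -(subrKA (h t)); apply: (le_lt_trans (ler_normD _ _)).
  move: h1 hy; rewrite /restr mem_set// distrC => h1 hy.
  by rewrite [ltRHS]mulr_natl mulr2n; exact: ltrD.
exfalso; suff : mu S = 0 by move=> S00; rewrite S00 ltxx in S0.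
have BN n : mu.-negligible (\bigcup_k B n k).
  apply: negligible_bigcup => k; apply/negligibleP => //.
  apply/eqP; rewrite -measure_le0 leNgt; apply/negP => Bnk.
  by apply: B0; exists n, k.
apply/negligibleP => //; apply: negligibleS (negligibleU sh (negligible_bigcup BN)).
move=> t St; apply: contrapT => /not_orP[/contrapT st nB]; apply: nB.
have /interiorP[r r0 rK] := Kh t St.
have r30 : 0 < r / 3 by rewrite divr_gt0.
have [k _ /(_ k (leqnn k)) /= kr] := near_infty_natSinv_lt (PosNum r30).
have k0 : 0 < k.+1%:R^-1 :> R by rewrite invr_gt0.
have /cvgrPdist_lt/(_ _ k0)[n _ /(_ n (leqnn n)) /= hn] := st.
exists n => //; exists k => //; split=> //; split=> //= y hy.
apply: rK; rewrite -(subrKA (simple_fun (s n) t)).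
apply: (le_lt_trans (ler_normD _ _)).
by move: hn hy kr; rewrite /restr mem_set//; move: (k.+1%:R^-1) => c; lra.
Qed.

(** On a set of positive measure the values of [h] have a uniform margin [r] inside [K], so a
    multiple [c *: e] of an interior point, of norm below [r], can be subtracted there without
    leaving [K]. The integral is then a point of [K] plus a positive multiple of [e]. *)
Lemma has_bochner_interior (K : set Y) S h v : closed K -> K 0 ->
  (forall x y, K x -> K y -> K (x + y)) ->
  (forall (c : R) x, 0 <= c -> K x -> K (c *: x)) ->
  (exists x, interior K x) ->
  measurable S -> (0 < mu S)%E -> (forall t, S t -> interior K (h t)) ->
  has_bochner mu (restr S h) v -> interior K v.
Proof.
move=> cK K0 KD KZ [e ie] mS S0 Kh hv.
have [A [r [mA AS A0 r0 rK]]] := uniform_interior mS S0 hv.1 Kh.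
pose c := r / (`|e| + 1).
have e1 : 0 < `|e| + 1 by rewrite ltr_wpDl.
have c0 : 0 < c by rewrite divr_gt0.
have mA0 : 0 < fine (mu A) by rewrite fine_gt0// A0 -ge0_fin_numE// mu_fin.
have [w hw] : exists w, has_bochner mu (restr S (fun t => h t - restr A (fun=> c *: e) t)) w.
  exists (v - fine (mu A) *: (c *: e)).
  have := has_bochnerB mucomp hv (has_bochner_restr_cst mu (c *: e) mA).
  congr (has_bochner _ _ _); apply/funext => t; rewrite /restr.
  case: ifPn => // tS; case: ifPn; rewrite ?subr0// => tA.
  by exfalso; move/negP : tS; apply; rewrite inE; apply: AS; rewrite inE in tA.
have Kw : K w.
  apply: (has_bochner_cone mucomp mufin cK K0 KD KZ _ hw) => t; rewrite /restr.
  case: ifPn => // tS; case: ifPn => tA.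
    apply: rK (set_mem tA) _; rewrite opprB addrC subrK normrZ gtr0_norm//.
    by rewrite /c mulrAC ltr_pdivrMr// ltr_pM2l// ltrDl.
  by rewrite subr0; apply: interior_subset; exact/Kh/set_mem.
have -> : v = w + (fine (mu A) * c) *: e.
  apply: (has_bochner_unique mucomp mufin hv).
  have := has_bochnerD mucomp hw (has_bochner_restr_cst mu (c *: e) mA).
  rewrite scalerA; congr (has_bochner _ _ _); apply/funext => t; rewrite /restr.
  case: ifPn => tS; first by rewrite subrK.
  rewrite ifN ?addr0//; apply: contra tS => tA; apply/mem_set/AS; exact: set_mem tA.
by apply: interiorD => //; apply: interiorZ => //; rewrite mulr_gt0.
Qed.

End BochnerIntegralOnSets.

(** * Atomless measures *)

Section Atomless.
Context {d : measure_display} {T : measurableType d} {R : realType}.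
Variable mu : {measure set T -> \bar R}.
Hypothesis mufin : (mu setT < +oo)%E.
Variable A0 : set T.
Hypothesis atomless : atomless_on mu A0.
Implicit Types A B C F : set T.
Local Notation m A := (fine (mu A)).

Lemma fine_mu_gt0 A : measurable A -> (0 < mu A)%E <-> 0 < m A.
Proof. by move=> mA; rewrite -[X in (_ < X)%E <-> _]fine_muE. Qed.

Lemma fine_mu_le A B : measurable A -> measurable B -> A `<=` B -> m A <= m B.
Proof. by move=> mA mB AB; rewrite -lee_fin !fine_muE//; apply: le_measure; rewrite ?inE. Qed.

Lemma fine_muD A B : measurable A -> measurable B -> A `<=` B ->
  m (B `\` A) = m B - m A.
Proof. by move=> mA mB AB; rewrite (@fine_muID _ _ _ _ mufin A B)// setIidr// addrC addKr. Qed.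

(** Of the two parts of a proper splitting, one has at most half the measure. The linear bound,
    weaker than the geometric one, is inductive because [n.+2 / 2 <= n.+1], and the Archimedean
    property concludes. *)
Lemma atomless_small B (e : R) : measurable B -> B `<=` A0 -> 0 < m B -> 0 < e ->
  exists C, [/\ measurable C, C `<=` B, 0 < m C & m C <= e].
Proof.
move=> mB BA0 B0 e0.
suff H n : exists C, [/\ measurable C, C `<=` B, 0 < m C & n.+1%:R * m C <= m B].
  have [C [mC CB C0 hC]] := H (Num.truncn (m B / e)).
  exists C; split=> //.
  have : m B / e < (Num.truncn (m B / e)).+1%:R by rewrite truncnS_gt.
  rewrite ltr_pdivrMr// => Be; rewrite -(@ler_pM2l _ (Num.truncn (m B / e)).+1%:R)//.
  exact: le_trans hC (ltW Be).
elim: n => [|n [C [mC CB C0 hC]]]; first by exists B; split=> //; rewrite mul1r.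
have [C' [mC' C'C]] := atomless mC (subset_trans CB BA0) ((fine_mu_gt0 mC).2 C0).
move=> /(fine_mu_gt0 mC') C'0; rewrite -(fine_muE mufin mC) -(fine_muE mufin mC') lte_fin => C'lt.
have mD : measurable (C `\` C') by exact: measurableD.
have DE := fine_muD mC' mC C'C.
have n1 : n.+2%:R * (m C / 2) <= n.+1%:R * m C.
  have : 0 <= n%:R * m C by rewrite mulr_ge0// ltW.
  rewrite -[n.+2]addn2 -[n.+1]addn1 !natrD => nC.
  rewrite -subr_ge0 (_ : _ - _ = n%:R * m C / 2); first by rewrite divr_ge0.
  by field.
have [h|h] := leP (m C') (m C / 2).
  exists C'; split=> //; first exact: subset_trans CB.
  by apply: le_trans hC; apply: le_trans n1; rewrite ler_wpM2l.
exists (C `\` C'); split=> //.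
- exact: subset_trans CB.
- by rewrite DE subr_gt0.
by apply: le_trans hC; apply: le_trans n1; rewrite ler_wpM2l// DE; lra.
Qed.

(* Greedy exhaustion: at each step adjoin a piece of at least half the largest
   admissible measure; a deficit in the limit would leave room for a small
   piece admissible at every step. *)
Lemma atomless_intermediate B (c : R) : measurable B -> B `<=` A0 ->
  0 <= c <= m B -> exists C, [/\ measurable C, C `<=` B & m C = c].
Proof.
move=> mB BA0 /andP[c0 cB].
pose adm D F := [/\ measurable F, F `<=` B `\` D & m D + m F <= c].
(* The conditions on [D] stand under the existential so that a piece can be chosen for every set and
   [nxt] is a total function; [set0] is the default. *)
have step D : exists F, measurable D -> m D <= c ->
    adm D F /\ forall F', adm D F' -> m F' <= 2 * m F.
  have [mD|] := pselect (measurable D); last by exists set0.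
  have [Dc|] := pselect (m D <= c); last by exists set0.
  have adm0 : adm D set0 by split => //; rewrite measure0 addr0.
  pose E := [set m F | F in [set F | adm D F]].
  have hE : has_sup E.
    split; first by exists (m set0), set0.
    by exists c => _ [F [mF _ hF] <-]; apply: le_trans hF; rewrite lerDr fine_ge0.
  have supE F : adm D F -> m F <= sup E.
    by move=> aF; apply: ub_le_sup; [exact: hE.2|exists F].
  have : 0 <= sup E by have := supE _ adm0; rewrite measure0.
  rewrite le_eqVlt => /orP[/eqP s0|s0].
    by exists set0 => _ _; split=> // F' /supE; rewrite -s0 measure0 mulr0.
  have [|_ [F aF <-] hF] := @sup_adherent _ E (sup E / 2) _ hE; first by rewrite divr_gt0.
  exists F => _ _; split=> // F' /supE h; apply: (le_trans h); lra.
pose nxt D := D `|` sval (cid (step D)).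
pose D n := iter n nxt set0.
have HD n : [/\ measurable (D n), D n `<=` B & m (D n) <= c].
  elim: n => [|n [mD DB Dc]]; first by rewrite /D /=; split=> //; rewrite measure0.
  have [[mF FB Fc] _] := svalP (cid (step (D n))) mD Dc.
  rewrite /D iterS -/(D n) /nxt; split.
  - exact: measurableU.
  - by move=> t [/DB|/FB[]].
  - rewrite fine_muU//; apply/seteqP; split=> // t [Dt /FB[_ nDt]]; exact: nDt.
have mD n : measurable (D n) by have [] := HD n.
have DS n : m (D n.+1) = m (D n) + m (sval (cid (step (D n)))).
  have [_ _ Dc] := HD n; have [[mF FB Fc] _] := svalP (cid (step (D n))) (mD n) Dc.
  rewrite /D iterS -/(D n) fine_muU//; apply/seteqP; split=> // t [Dt /FB[_ nDt]]; exact: nDt.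
have ndD : nondecreasing_seq D.
  by apply/nondecreasing_seqP => n; rewrite /D iterS; apply/subsetPset => t; left.
pose U := \bigcup_n D n.
have mU : measurable U by exact: bigcupT_measurable.
have UB : U `<=` B by move=> t [n _]; have [_ DB _] := HD n; exact: DB.
have Uc : m U <= c.
  rewrite -lee_fin fine_muE//.
  have cvg := nondecreasing_cvg_mu (mu := mu) mD mU ndD.
  rewrite -(cvg_lim _ cvg)//; apply: lime_le; first by apply/cvg_ex; exists (mu U).
  apply: nearW => n /=; have [_ _ Dc] := HD n.
  by rewrite -fine_muE// lee_fin.
exists U; split=> //; apply/eqP; rewrite eq_le Uc /= leNgt; apply/negP => Ult.
have mBU : measurable (B `\` U) by exact: measurableD.
have [|||F [mF FB F0 Fc]] := @atomless_small (B `\` U) (c - m U) mBU.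
- by move=> t [/BA0].
- by rewrite fine_muD// subr_gt0; apply: lt_le_trans cB.
- by rewrite subr_gt0.
have aF n : adm (D n) F.
  split=> //; first by move=> t /FB[Bt nU]; split=> // Dt; apply: nU; exists n.
  have : m (D n) <= m U by apply: fine_mu_le => // t Dt; exists n.
  by move: Fc; lra.
have grow n : n%:R * (m F / 2) <= m (D n).
  elim: n => [|n IH]; first by rewrite mul0r fine_ge0.
  have [_ _ Dc] := HD n; have [_ /(_ _ (aF n))] := svalP (cid (step (D n))) (mD n) Dc.
  by rewrite DS -[n.+1]addn1 natrD mulrDl; move: IH; lra.
have F20 : 0 < m F / 2 by rewrite divr_gt0.
have := grow (Num.truncn (c / (m F / 2))).+1.
have : c / (m F / 2) < (Num.truncn (c / (m F / 2))).+1%:R by rewrite truncnS_gt.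
rewrite ltr_pdivrMr// => h1 h2.
have [_ _ h3] := HD (Num.truncn (c / (m F / 2))).+1.
by have := lt_le_trans h1 (le_trans h2 h3); rewrite ltxx.
Qed.

(** Splitting [B] along the head set [A] and treating both halves by induction gives a union
    proportional for [A], through the half inside [A], and for every other set, by additivity. The
    list may therefore overlap in any way. *)
Lemma atomless_proportional (lam : R) (As : seq (set T)) B :
  0 <= lam <= 1 -> {in As, forall A, measurable A} -> measurable B -> B `<=` A0 ->
  exists C, [/\ measurable C, C `<=` B, m C = lam * m B &
    {in As, forall A, m (A `&` C) = lam * m (A `&` B)}].
Proof.
move=> /andP[l0 l1]; elim: As B => [|A As IH] B mAs mB BA0.
  have [|C [mC CB hC]] := @atomless_intermediate B (lam * m B) mB BA0.
    by rewrite mulr_ge0 ?fine_ge0//= ler_piMl// fine_ge0.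
  by exists C; split.
have mA : measurable A by apply: mAs; rewrite mem_head.
have mAs' : {in As, forall A, measurable A}.
  by move=> A' A's; apply: mAs; rewrite in_cons A's orbT.
have mB1 : measurable (B `&` A) by exact: measurableI.
have mB2 : measurable (B `\` A) by exact: measurableD.
have [|C1 [mC1 C1B hC1 hC1s]] := IH _ mAs' mB1; first by move=> t [/BA0].
have [|C2 [mC2 C2B hC2 hC2s]] := IH _ mAs' mB2; first by move=> t [/BA0].
exists (C1 `|` C2); split.
- exact: measurableU.
- by move=> t [/C1B[]|/C2B[]].
- rewrite fine_muU//; first by rewrite hC1 hC2 -mulrDr -fine_muID.
  by apply/seteqP; split=> // t [/C1B[_ At] /C2B[_ /(_ At)]].
move=> A'; rewrite in_cons => /orP[/eqP->|A's].
  have -> : A `&` (C1 `|` C2) = C1.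
    apply/seteqP; split=> t; first by move=> [At [//|/C2B[_ /(_ At)]]].
    by move=> C1t; have [_ At] := C1B _ C1t; split=> //; left.
  by rewrite hC1 setIC.
have mA' := mAs' _ A's.
rewrite setIUr fine_muU//; last 3 first.
- exact: measurableI.
- exact: measurableI.
- by apply/seteqP; split=> // t [[_ /C1B[_ At]] [_ /C2B[_ /(_ At)]]].
rewrite hC1s// hC2s// -mulrDr; congr (_ * _).
rewrite [A' `&` (B `\` A)]setIDA [A' `&` (B `&` A)]setIA.
by rewrite -fine_muID//; exact: measurableI.
Qed.

(** The singleton is not assumed measurable, so it is enclosed in measurable sets: halving and
    keeping the half that contains [t] gives sets of measure [m A0 / 2 ^+ n], whose intersection is
    null. *)
Lemma atomless_singleton t : measurable A0 -> A0 t -> mu.-negligible [set t].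
Proof.
move=> mA0 A0t.
have H n : exists B, [/\ measurable B, B `<=` A0, B t & m B = m A0 / 2 ^+ n].
  elim: n => [|n [B [mB BA0 Bt hB]]]; first by exists A0; split=> //; rewrite expr0 divr1.
  have hB2 : m B / 2 = m A0 / 2 ^+ n.+1 by rewrite hB exprSr invfM mulrA mulrAC.
  have [|C [mC CB hC]] := @atomless_intermediate B (m B / 2) mB BA0.
    by have := fine_ge0 (measure_ge0 mu B); lra.
  have [Ct|nCt] := pselect (C t).
    by exists C; split=> //; [exact: subset_trans BA0|rewrite hC].
  exists (B `\` C); split=> //; first exact: measurableD.
    by move=> s [/BA0].
  by rewrite fine_muD// hC -hB2; lra.
pose N := \bigcap_n sval (cid (H n)).
have mN : measurable N.
  by apply: bigcapT_measurable => n; have [] := svalP (cid (H n)).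
exists N; split=> //; last first.
  by move=> _ -> n _; have [] := svalP (cid (H n)).
rewrite -fine_muE//; congr EFin; apply/eqP; rewrite eq_le fine_ge0// andbT.
have le n : m N <= m A0 / 2 ^+ n.
  have [mB _ _ <-] := svalP (cid (H n)); apply: fine_mu_le => // s; exact.
apply/ler_addgt0Pr => e e0; rewrite add0r.
have cvg : (fun n => m A0 * 2^-1 ^+ n) @ \oo --> m A0 * 0.
  by apply: cvgMr; apply: cvg_expr; rewrite ger0_norm//; lra.
have /cvgrPdist_lt/(_ e e0)[n _ /(_ n (leqnn n))] := cvg.
rewrite mulr0 sub0r normrN ger0_norm ?mulr_ge0 ?fine_ge0 ?exprn_ge0// exprVn => /ltW.
exact: le_trans.
Qed.

End Atomless.

(** * Approximate convexity of Bochner integrals over atomless sets *)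

Section Lyapunov.
Context {d : measure_display} {T : measurableType d} {R : realType}
  {Y : completeNormedModType R}.
Variable mu : {measure set T -> \bar R}.
Hypothesis mucomp : measure_is_complete mu.
Hypothesis mufin : (mu setT < +oo)%E.

(* Approximate Lyapunov convexity: exact for simple functions by proportional
   splitting, hence approximate for Bochner integrable ones. *)
Lemma approx_lyapunov (I : finType) (h : I -> T -> Y) (v : I -> Y) (A0 : set T)
    (lam e : R) : measurable A0 -> atomless_on mu A0 -> 0 <= lam <= 1 -> 0 < e ->
  (forall i, has_bochner mu (h i) (v i)) ->
  exists C, [/\ measurable C, C `<=` A0 & forall i w w',
    has_bochner mu (restr C (h i)) w -> has_bochner mu (restr A0 (h i)) w' ->
    `|w - lam *: w'| <= e].
Proof.
move=> mA0 atl /andP[l0 l1] e0 hv; have e20 : 0 < e / 2 by rewrite divr_gt0.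
pose s i := sval (cid ((hv i).2 _ e20)).
have Hs i : msimple (s i) /\ (L1norm mu (fun t => h i t - simple_fun (s i) t)%R <= (e / 2)%:E)%E.
  by have [] := svalP (cid ((hv i).2 _ e20)).
have [||C [mC CA0 _ hC]] := @atomless_proportional _ _ _ mu mufin A0 atl lam
    (flatten [seq unzip1 (s i) | i <- enum I]) A0 _ _ mA0 (@subset_refl _ _).
- by rewrite l0.
- by move=> A /flatten_mapP[i _ /mapP[p ps ->]]; exact: (Hs i).1.
exists C; split=> // i w w' hw hw'.
have E : simple_int mu C (s i) = lam *: simple_int mu A0 (s i).
  rewrite /simple_int scaler_sumr; apply: eq_big_seq => p ps.
  rewrite scalerA hC//; apply/flatten_mapP; exists i; first by rewrite mem_enum.
  exact: map_f.
have h1 := has_bochner_restr_dist mucomp mufin mC (hv i).1 hw (Hs i).1.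
have h2 := has_bochner_restr_dist mucomp mufin mA0 (hv i).1 hw' (Hs i).1.
have {}h1 := le_trans h1 (Hs i).2; have {}h2 := le_trans h2 (Hs i).2.
rewrite lee_fin in h1; rewrite lee_fin in h2.
rewrite -(subrKA (simple_int mu C (s i))) (splitr e).
apply: (le_trans (ler_normD _ _)); apply: lerD => //.
rewrite E -scalerBr normrZ ger0_norm// distrC; apply: le_trans h2.
by rewrite ler_piMl.
Qed.

End Lyapunov.

(** * Scalar integrals and countable sets *)

Section Integration.
Context {d : measure_display} {T : measurableType d} {R : realType}.
Variable mu : {measure set T -> \bar R}.
Hypothesis mufin : (mu setT < +oo)%E.

(** The integrand [g + k] may change sign, and its integrability has to be derived: its negative
    part is at most [|k|], hence integrable, and the bound [M] then excludes an infinite positive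
    part. In the use below [k] is the utility of the zero bundle. *)
Lemma integral_shift_le (D : set T) (g : T -> R) (k M : R) : measurable D ->
  measurable_fun D g -> (forall t, D t -> 0 <= g t) ->
  (\int[mu]_(t in D) (g t + k)%:E <= M%:E)%E ->
  (\int[mu]_(t in D) (g t)%:E <= (M - k * fine (mu D))%:E)%E.
Proof.
move=> mD mg g0 hM; pose u : T -> \bar R := EFin \o (fun t => g t + k).
have mu_ : measurable_fun D u.
  by apply/measurable_EFinP; apply: measurable_funD => //; exact: measurable_cst.
have mkfin : (\int[mu]_(t in D) (cst `|k|%:E) t < +oo)%E.
  by rewrite integral_cst// -fine_muE// -EFinM ltry.
have negfin : (\int[mu]_(t in D) (u^\- t) < +oo)%E.
  apply: le_lt_trans mkfin; apply: ge0_le_integral => //.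
  - exact: measurable_funeneg.
  - move=> t Dt; rewrite funenegE /u /= -EFin_max lee_fin ge_max normr_ge0 andbT.
    by have := g0 t Dt; have := ler_norm (- k); rewrite normrN; lra.
have negfin' : (\int[mu]_(t in D) (u^\- t) \is a fin_num)%E.
  by rewrite ge0_fin_numE// integral_ge0.
have posfin : (\int[mu]_(t in D) (u^\+ t) < +oo)%E.
  rewrite ltNge leye_eq; apply/negP => /eqP posy; move: hM.
  rewrite -/(u _) (_ : (\int[mu]_(t in D) (g t + k)%:E)%E = (\int[mu]_(t in D) u t)%E)//.
  by rewrite integralE posy; move: negfin'; case: (integral _ _ _).
have iu : mu.-integrable D u.
  apply/integrableP; split=> //.
  rewrite (_ : (fun t => `|u t|)%E = abse \o u)// fune_abse ge0_integralD//.
  - by rewrite lte_add_pinfty.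
  - exact: measurable_funepos.
  - exact: measurable_funeneg.
have ik : mu.-integrable D (EFin \o cst k).
  apply/integrableP; split; first exact/measurable_EFinP/measurable_cst.
  exact: mkfin.
rewrite (eq_integral (fun t => (g t + k)%:E - (cst k t)%:E)%E); last first.
  by move=> t _; rewrite -EFinB /= addrK.
rewrite (integralB_EFin mD iu ik) EFinB EFinM fine_muE//.
have Ik : (\int[mu]_(t in D) (cst k%:E) t = k%:E * mu D)%E by exact: integral_cst.
by rewrite -Ik; apply: leeB.
Qed.

Lemma measurable_countable (A : set T) : countable A ->
  (forall t, A t -> measurable [set t]) -> measurable A.
Proof.
move=> /countable_injP[f injf] m1.
have -> : A = \bigcup_n (A `&` f @^-1` [set n]).
  by apply/seteqP; split=> [t At|t [n _ []//]]; exists (f t).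
apply: bigcupT_measurable => n.
have [[t [At ft]]|nt] := pselect (exists t, A t /\ f t = n).
  rewrite (_ : _ `&` _ = [set t]); first exact: m1.
  apply/seteqP; split=> [s [As /= fs]|_ ->]; last by split.
  by apply: injf; rewrite ?inE// fs ft.
rewrite (_ : _ `&` _ = set0)//; apply/seteqP; split=> // t [At ft].
by apply: nt; exists t.
Qed.

(** The tail unions of the bad sets decrease to a null set, and a finite measure is continuous from
    above. *)
Lemma cvg_fine_mu_bad (P : nat -> T -> bool) (S : set T) : measurable S ->
  (forall n, measurable_fun setT (P n)) ->
  {ae mu, forall t, S t -> \forall n \near \oo, P n t} ->
  forall e : R, 0 < e -> \forall n \near \oo, fine (mu (S `\` [set t | P n t])) < e.
Proof.
move=> mS mP aP e e0.
have mA n : measurable (S `\` [set t | P n t]).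
  apply: measurableD => //.
  have := mP n measurableT [set true] I; rewrite setTI; congr measurable.
pose B n := \bigcup_(k in [set k | (n <= k)%N]) (S `\` [set t | P k t]).
have mB n : measurable (B n) by apply: bigcup_measurable => k _.
have mcap : measurable (\bigcap_n B n) by exact: bigcapT_measurable.
have ndB : nonincreasing_seq B.
  move=> n m nm; apply/subsetPset => t [k /= mk h]; exists k => //=.
  exact: leq_trans nm mk.
have B0 : (mu (B 0%N) < +oo)%E by rewrite -ge0_fin_numE// mu_fin.
have := nonincreasing_cvg_mu (mu := mu) B0 mB mcap ndB.
have -> : mu (\bigcap_n B n) = 0%E.
  apply/negligibleP => //; apply: negligibleS aP => t Bt /= h.
  have [k0 _ [St _]] := Bt 0%N I.
  have [N _ hN] := h St; have [k /= Nk [_]] := Bt N I; apply; exact: hN.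
move=> /fine_cvgP[_ /cvgrPdist_lt/(_ e e0)]; apply: filterS => n /=.
rewrite sub0r normrN ger0_norm ?fine_ge0//; apply: le_lt_trans.
by apply: fine_mu_le => // t h; exists n => /=.
Qed.

End Integration.

(** * The economy *)

Section Economy.
Context {d : measure_display} {T : measurableType d} {R : realType}
  {Y : completeNormedModType R} {Om : finType}.
Variables (mu : {measure set T -> \bar R}) (T1 : set T) (Yp : set Y)
  (Pi : T -> {set {set Om}}) (U : T -> Om -> Y -> R) (q : T -> Om -> R)
  (a : T -> Om -> Y).
Hypothesis hE : economy mu T1 Yp Pi U q a.
Implicit Types (f g h : T -> Om -> Y) (S : set T) (w : Om) (x y : Om -> Y).

Lemma economy_complete : measure_is_complete mu.
Proof. by case: hE => -[]. Qed.
Let mucomp := economy_complete.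

Lemma economy_finite : (mu setT < +oo)%E.
Proof. by case: hE => -[]. Qed.
Let mufin := economy_finite.

Lemma economy_atomless : atomless_on mu (~` T1).
Proof. by case: hE => -[]. Qed.

Lemma atom_measurable t : T1 t -> measurable [set t].
Proof. by case: hE => -[_ _ _ h _] _ _ _ _ /h[]. Qed.

Lemma atom_gt0 t : T1 t -> 0 < fine (mu [set t]).
Proof.
move=> T1t; apply/fine_mu_gt0 => //; first exact: atom_measurable.
by case: hE => -[_ _ _ h _] _ _ _ _; have [] := h t T1t.
Qed.

Lemma large_measurable : measurable T1.
Proof.
apply: measurable_countable => [|t]; last exact: atom_measurable.
by case: hE => -[].
Qed.
Let mT1 := large_measurable.

Lemma cone_closed : closed Yp. Proof. by case: hE => _ [[]]. Qed.
Lemma cone0 : Yp 0. Proof. by case: hE => _ [[]]. Qed.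
Lemma coneD (x y : Y) : Yp x -> Yp y -> Yp (x + y).
Proof. by case: hE => _ [[_ _ [h _] _ _] _] _ _ _; exact: h. Qed.
Lemma coneZ (c : R) (x : Y) : 0 <= c -> Yp x -> Yp (c *: x).
Proof. by case: hE => _ [[_ _ [_ h] _ _] _] _ _ _; exact: h. Qed.
Lemma cone_interior : exists x : Y, interior Yp x.
Proof. by case: hE => _ [[]]. Qed.

Lemma endowment_cone t w : Yp (a t w).
Proof. by case: hE => _ _ [h _] _ _; exact: h. Qed.

Lemma endowment_join t : join_meas Pi setT (a t).
Proof.
by case: hE => _ _ [_ h] _ _ w w' ww'; apply: h; exact: ww'.
Qed.

Lemma prior_gt0 t w : 0 < q t w.
Proof. by case: hE => _ _ _ [h _] _; exact: h. Qed.

Lemma prior_sum t : \sum_(w : Om) q t w = 1.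
Proof. by case: hE => _ _ _ [_ h] _; exact: h. Qed.

Lemma endowment_bochner w :
  has_bochner mu (fun t => a t w) (bint mu setT (fun t => a t w)).
Proof.
rewrite -[X in has_bochner _ X _]restrT; apply: has_bochner_bint => //.
by case: hE.
Qed.

(** The almost everywhere clauses become clauses for every agent, and integrability is required over
    the whole space, so that bundles can be pasted along measurable sets of agents. *)
Definition join_allocation h := [/\ forall t w, Yp (h t w),
  forall t, join_meas Pi setT (h t) &
  forall w, exists v, has_bochner mu (fun t => h t w) v].

Lemma allocation_smeas h w : join_allocation h -> smeas mu (fun t => h t w).
Proof. by move=> [_ _ /(_ w)[v []]]. Qed.

Lemma join_allocation_if S h h' : measurable S ->
  join_allocation h -> join_allocation h' ->
  join_allocation (fun t => if t \in S then h t else h' t).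
Proof.
move=> mS [hp hj hb] [hp' hj' hb']; split.
- by move=> t w; case: ifP.
- by move=> t; case: ifP.
move=> w; have [v hv] := hb w; have [v' hv'] := hb' w.
have [u hu] := has_bochner_restr mucomp mufin mS hv.
have [u' hu'] := has_bochner_restr mucomp mufin (measurableC mS) hv'.
exists (u + u'); have := has_bochnerD mucomp hu hu'.
congr (has_bochner _ _ _); apply/funext => t; rewrite /restr in_setC.
by case: (t \in S); rewrite ?addr0 ?add0r.
Qed.

Lemma join_allocation_scale (c : R) h : 0 <= c ->
  join_allocation h -> join_allocation (fun t w => c *: h t w).
Proof.
move=> c0 [hp hj hb]; split.
- by move=> t w; exact: coneZ.
- by move=> t w w' ww'; congr (_ *: _); exact: hj.
- by move=> w; have [v hv] := hb w; exists (c *: v); exact: has_bochnerZ.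
Qed.

Lemma join_allocation_cst x : (forall w, Yp (x w)) -> join_meas Pi setT x ->
  join_allocation (fun=> x).
Proof.
move=> xp xj; split=> // w; exists (fine (mu setT) *: x w).
by rewrite -[X in has_bochner _ X _]restrT; exact: has_bochner_restr_cst.
Qed.

(** Outside [S], and where measurability fails, the agent receives its endowment, which is in the
    cone and measurable for its own partition, hence for the pooled information. *)
Lemma normalize_allocation S g : measurable S -> assignment mu Yp S g ->
  {ae mu, forall t, S t -> join_meas Pi setT (g t)} ->
  exists g0, [/\ join_allocation g0,
    forall w, has_bochner mu (restr S (fun t => g0 t w)) (bint mu S (fun t => g t w)) &
    {ae mu, forall t, S t -> g0 t = g t}].
Proof.
move=> mS [gp gi] gj.
pose g0 t := if (t \in S) && `[< join_meas Pi setT (g t) >] then g t else a t.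
have g0S : {ae mu, forall t, S t -> g0 t = g t}.
  apply: filterS gj => t h St; rewrite /g0 mem_set//=.
  by case: asboolP => // /(_ (h St)).
have g0v w : has_bochner mu (restr S (fun t => g0 t w)) (bint mu S (fun t => g t w)).
  apply: (has_bochner_ae mucomp (h := restr S (fun t => g t w))); last exact: has_bochner_bint.
  apply: filterS g0S => t h; rewrite /restr; case: ifPn => // tS.
  by rewrite h//; exact: set_mem.
exists g0; split=> //; split.
- move=> t w; rewrite /g0; case: ifP => [/andP[tS _]|_]; last exact: endowment_cone.
  by apply: gp; exact: set_mem.
- move=> t; rewrite /g0; case: ifP => [/andP[_ /asboolP//]|_]; exact: endowment_join.
move=> w; have mC := measurableC mS.
have [u hu] := has_bochner_restr mucomp mufin mC (endowment_bochner w).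
exists (bint mu S (fun t => g t w) + u); have := has_bochnerD mucomp (g0v w) hu.
congr (has_bochner _ _ _); apply/funext => t; rewrite /restr in_setC /g0.
by case: (t \in S); rewrite ?addr0 ?add0r.
Qed.

(** * Expected utilities and the creation of an interior slack *)

Hypothesis hA2 : A2 Yp U.
Hypothesis hA3 : A3 Yp U.
Hypothesis hA5 : A5 Yp a.
Hypothesis hA1 : A1 mu Pi q.

Lemma utility_cvg t w (u : nat -> Y) (x : Y) : Yp x -> (forall n, Yp (u n)) ->
  u @ \oo --> x -> U t w (u n) @[n --> \oo] --> U t w x.
Proof. by apply: within_continuous_cvg; exact: hA2.2. Qed.

(** [A3] compares bundles only along interior increments. For [x] on the boundary of the cone, the
    interior bundles [x + e / n.+1] are compared with 0, and continuity on the cone gives the weak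
    inequality in the limit. *)
Lemma utility_ge0 t w (x : Y) : Yp x -> U t w 0 <= U t w x.
Proof.
move=> xp; have [e ie] := cone_interior; have ep := interior_subset ie.
have ux : (fun n => x + n.+1%:R^-1 *: e) @ \oo --> x.
  rewrite -[X in _ --> X]addr0 -(scale0r e).
  by apply: cvgD; [exact: cvg_cst|apply: cvgZl; exact: cvg_harmonic].
have up n : Yp (x + n.+1%:R^-1 *: e).
  by apply: coneD => //; apply: coneZ; rewrite ?invr_ge0.
have uc := utility_cvg (t := t) (w := w) xp up ux.
apply: (@closed_cvg _ _ \oo _ _ (fun r => U t w 0 <= r) (@closed_ge R _) _ _ uc).
apply: nearW => n; have : interior Yp (x + n.+1%:R^-1 *: e).
  by apply: interiorD => //; [exact: coneD|apply: interiorZ => //; exact: coneZ].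
by move=> /(hA3 t w cone0 (up n)); rewrite add0r => /ltW.
Qed.

Lemma Vexp_mono t x y : (forall w, Yp (x w)) -> (forall w, interior Yp (y w)) ->
  Vexp U q t x < Vexp U q t (fun w => x w + y w).
Proof.
move=> xp yi; rewrite /Vexp.
(* Strictness of a sum needs at least one state; over an empty [Om] the priors would sum to 0
   instead of 1. *)
have [w0 _|Om0] := pickP (@predT Om); last first.
  have := prior_sum t; rewrite big_pred0// => /eqP.
  by rewrite eq_sym oner_eq0.
apply: ltr_sum; first by apply/hasP; exists w0 => //; rewrite mem_index_enum.
move=> w _; rewrite ltr_pM2r ?prior_gt0//; apply: hA3 => //; last exact: yi.
exact: interior_subset.
Qed.

Lemma measurable_Vexp h : (forall t w, Yp (h t w)) ->
  (forall w, smeas mu (fun t => h t w)) ->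
  measurable_fun setT (fun t => Vexp U q t (h t)).
Proof.
move=> hp hm; apply: measurable_sum => w; apply: measurable_funM.
  apply: (smeas_comp (F := U ^~ w) mucomp cone_closed (hm w) (fun t => hp t w)).
    by move=> y yp; exact: hA2.1.
  by move=> t; exact: hA2.2.
exact: hA1.1.
Qed.

Lemma Vexp_cvg t (u : nat -> Om -> Y) x : (forall w, Yp (x w)) ->
  (forall n w, Yp (u n w)) -> (forall w, u ^~ w @ \oo --> x w) ->
  Vexp U q t (u n) @[n --> \oo] --> Vexp U q t x.
Proof.
move=> xp up ux; apply: cvg_big => //; first exact: add_continuous.
by move=> w _; apply: cvgMl; exact: utility_cvg.
Qed.

(* On the set where [(1 - c) g] is still weakly preferred to [f], replace [g]
   by [(1 - c) g]; the slack becomes [(1 - c) z + c (int_S a - o(1))]. *)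
Lemma interior_slack S f g (z : Om -> Y) : measurable S -> (0 < mu S)%E ->
  join_allocation f -> join_allocation g -> (forall w, Yp (z w)) ->
  (forall w, has_bochner mu (restr S (fun t => a t w - g t w)) (z w)) ->
  {ae mu, forall t, S t -> Vexp U q t (f t) < Vexp U q t (g t)} ->
  exists g' (z' : Om -> Y), [/\ join_allocation g', forall w, interior Yp (z' w),
    forall w, has_bochner mu (restr S (fun t => a t w - g' t w)) (z' w) &
    {ae mu, forall t, S t -> Vexp U q t (f t) <= Vexp U q t (g' t)}].
Proof.
move=> mS S0 fa ga zp hz fg; have [gp gj gb] := ga; have [fp _ _] := fa.
pose c n : R := n.+1%:R^-1.
have c0 n : 0 < c n by rewrite invr_gt0.
have c1 n : 0 <= 1 - c n by rewrite subr_ge0 invf_le1// ler1n.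
pose G n t w := (1 - c n) *: g t w.
have Ga n : join_allocation (G n) by exact: join_allocation_scale.
pose P n t := Vexp U q t (f t) <= Vexp U q t (G n t).
have mP n : measurable_fun setT (P n).
  apply: measurable_fun_ler; apply: measurable_Vexp => //.
  - by move=> w; exact: allocation_smeas.
  - by case: (Ga n).
  - by move=> w; exact: allocation_smeas.
have mPs n : measurable [set t | P n t].
  have := mP n measurableT [set true] I; rewrite setTI; congr measurable.
have aP : {ae mu, forall t, S t -> \forall n \near \oo, P n t}.
  apply: filterS fg => t h St.
  have : Vexp U q t (G n t) @[n --> \oo] --> Vexp U q t (g t).
    apply: Vexp_cvg => //; first by move=> n w; case: (Ga n).
    move=> w; rewrite -[X in _ --> X]scale1r; apply: cvgZl.
    by rewrite -[X in _ --> X]subr0; apply: cvgB; [exact: cvg_cst|exact: cvg_harmonic].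
  move=> /cvgrPdist_lt/(_ (Vexp U q t (g t) - Vexp U q t (f t))).
  rewrite subr_gt0 => /(_ (h St)); apply: filterS => n hn.
  by have := ler_norm (Vexp U q t (g t) - Vexp U q t (G n t)); rewrite /P; move: hn; lra.
have Sa w : exists v, has_bochner mu (restr S (fun t => a t w)) v.
  exact: has_bochner_restr (endowment_bochner w).
pose A w := sval (cid (Sa w)).
have hA w : has_bochner mu (restr S (fun t => a t w)) (A w) := svalP (cid (Sa w)).
have iA w : interior Yp (A w).
  apply: (has_bochner_interior mucomp mufin cone_closed cone0 coneD coneZ cone_interior mS S0 _ (hA w)).
  by move=> t _; exact: hA5.
pose small w n := forall v,
  has_bochner mu (restr (S `\` [set t | P n t]) (fun t => g t w)) v ->
  interior Yp (A w - v).
have near_small w : \forall n \near \oo, small w n.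
  have [r r0 rK] := (interiorP _ _).1 (iA w).
  have r20 : 0 < r / 2 by rewrite divr_gt0.
  have [gv hgv] := gb w.
  have [del del0 hdel] := has_bochner_abs_cont mucomp mufin hgv r20.
  have := cvg_fine_mu_bad mufin mS mP aP del0; apply: filterS => n hn v hv.
  have {}hv := hdel _ _ (measurableD mS (mPs n)) hn hv.
  apply/interiorP; exists (r / 2) => // y hy; apply: rK.
  rewrite -(subrKA (A w - v)); apply: (le_lt_trans (ler_normD _ _)).
  by rewrite subKr; move: hv hy; lra.
have [n _ /(_ n (leqnn n)) hn] := filter_forall (f := small) (F := \oo) _ near_small.
pose D := S `&` [set t | P n t].
have mD : measurable D by exact: measurableI.
exists (fun t => if t \in D then G n t else g t).
have Gb w : exists v, has_bochner mu (restr (S `\` [set t | P n t]) (fun t => g t w)) v.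
  by have [gv hgv] := gb w; apply: has_bochner_restr hgv => //; exact: measurableD.
pose v w := sval (cid (Gb w)).
have hv w : has_bochner mu (restr (S `\` [set t | P n t]) (fun t => g t w)) (v w).
  exact: svalP (cid (Gb w)).
(* Where the bundle is scaled, [a - (1 - c) g = (1 - c) (a - g) + c a]; on the rest of [S],
   [a - g = (1 - c) (a - g) + c (a - g)]. Hence the slack, with [A] the integral of [a] over [S] and
   [v] that of [g] over the unscaled part. *)
exists (fun w => (1 - c n) *: z w + c n *: (A w - v w)); split.
- exact: join_allocation_if.
- move=> w; apply: interiorD; [exact: coneD|exact: coneZ|].
  by apply: interiorZ => //; [exact: coneZ|exact: hn].
- move=> w.
  have := has_bochnerD mucomp (has_bochnerZ mucomp (1 - c n) (hz w))
    (has_bochnerZ mucomp (c n) (has_bochnerB mucomp (hA w) (hv w))).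
  congr (has_bochner _ _ _); apply/funext => t; rewrite /restr /D /G in_setI in_setD.
  have -> : (t \in [set t | P n t]) = P n t by apply/idP/idP => [/set_mem|/mem_set].
  case: (t \in S) => /=; last by rewrite scaler0 subrr scaler0 addr0.
  case: (P n t) => /=.
    by rewrite subr0 scalerBr addrAC -scalerDl subrK scale1r.
  by rewrite -scalerDl subrK scale1r.
- apply: filterS fg => t ft St; rewrite /D in_setI (mem_set St) /=.
  by case: ifPn => [/set_mem//|_]; exact/ltW/ft.
Qed.

(** * Pooling the information of the whole economy *)

Lemma null_small_agent t : ~ T1 t -> mu.-negligible [set t].
Proof.
move=> nT1; apply: (atomless_singleton mufin economy_atomless) => //.
exact: measurableC.
Qed.

Hypothesis hA6 : A6 T1 Pi U q a.

(* One null agent of each information type held by a small agent, together with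
   one large agent, pools the information of the whole economy. *)
Lemma null_pooling : exists N : set T, [/\ measurable N, mu.-negligible N &
  forall S w w' t1, T1 t1 -> S t1 ->
    join_rel Pi (S `|` N) w w' -> join_rel Pi setT w w'].
Proof.
pose NQ (Q : {set {set Om}}) : set T :=
  if pselect (exists t, ~ T1 t /\ Pi t = Q) is left h then [set sval (cid h)] else set0.
have nNQ Q : mu.-negligible (NQ Q).
  rewrite /NQ; case: pselect => [h|_]; last exact: negligible_set0.
  by have [nT1 _] := svalP (cid h); exact: null_small_agent.
pose N := \big[setU/set0]_(Q : {set {set Om}}) NQ Q.
have nN : mu.-negligible N.
  by rewrite /N; elim/big_ind : _ => //; [exact: negligible_set0|exact: negligibleU].
exists N; split => //; first exact: mucomp.
move=> S w w' t1 T1t1 St1 SN t _.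
have [T1t|nT1t] := pselect (T1 t).
  by have [-> _ _ _] := hA6 T1t T1t1; apply: SN; left.
have [t' [Nt' <-]] : exists t', N t' /\ Pi t' = Pi t; last by apply: SN; right.
have h : exists s, ~ T1 s /\ Pi s = Pi t by exists t.
exists (sval (cid h)); split; last by case: (svalP (cid h)).
rewrite /N (bigD1 (Pi t))//=; left; rewrite /NQ.
by case: pselect => // h'; rewrite (Prop_irrelevance h h').
Qed.

(** The slack inherits measurability for the pooled information from [a] and [h], so an equal share
    of it can be added to every bundle. The shares exhaust the slack, which makes feasibility exact,
    and are interior, which makes weak preference strict. The null set [N] supplies the missing
    information without affecting integrals or almost everywhere preferences. *)
Lemma NY_blocked_of_slack S f h t1 : measurable S -> T1 t1 -> S t1 ->
  join_allocation h ->
  (forall w, exists2 s, interior Yp s &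
    has_bochner mu (restr S (fun t => a t w - h t w)) s) ->
  {ae mu, forall t, S t -> Vexp U q t (f t) <= Vexp U q t (h t)} ->
  exists S', coalition mu S' /\ NY_fine_blocked mu Yp Pi U q a f S'.
Proof.
move=> mS T1t1 St1 [hp hj hb] hs hV.
have [N [mN nN joinN]] := null_pooling.
pose s w := s2val (cid2 (hs w)).
have si w : interior Yp (s w) := s2valP (cid2 (hs w)).
have sb w : has_bochner mu (restr S (fun t => a t w - h t w)) (s w) := s2valP' (cid2 (hs w)).
have sj w w' : join_rel Pi setT w w' -> s w = s w'.
  move=> ww'; apply: (has_bochner_unique mucomp mufin (sb w)).
  have := sb w'; congr (has_bochner _ _ _); congr restr; apply/funext => t.
  by rewrite (@endowment_join t _ _ ww') (hj t _ _ ww').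
have mSN : measurable (S `|` N) by exact: measurableU.
have mSN0 : 0 < fine (mu (S `|` N)).
  apply: lt_le_trans (atom_gt0 T1t1) _; apply: fine_mu_le => //.
    exact: atom_measurable.
  by move=> _ ->; left.
have aeN (X : T -> Y) : {ae mu, forall t, restr S X t = restr (S `|` N) X t}.
  apply: negligibleS nN => t /= h'; apply: contrapT => nNt; apply: h'.
  by rewrite /restr in_setU (memNset nNt) orbF.
pose g t w := h t w + (fine (mu (S `|` N)))^-1 *: s w.
have gi w : interior Yp ((fine (mu (S `|` N)))^-1 *: s w).
  by apply: interiorZ => //; [exact: coneZ|rewrite invr_gt0].
have gp t w : Yp (g t w) by apply: coneD => //; exact: (interior_subset (gi w)).
have mA w : exists A, has_bochner mu (restr (S `|` N) (fun t => a t w)) A.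
  exact: has_bochner_restr (endowment_bochner w).
have gb w A : has_bochner mu (restr (S `|` N) (fun t => a t w)) A ->
    has_bochner mu (restr (S `|` N) (fun t => g t w)) A.
  move=> hA.
  have h1 := has_bochner_ae mucomp (aeN _) (sb w).
  have h2 := has_bochner_restr_cst mu ((fine (mu (S `|` N)))^-1 *: s w) mSN.
  have := has_bochnerD mucomp (has_bochnerB mucomp hA h1) h2.
  rewrite scalerA mulfV ?gt_eqF// scale1r subrK.
  congr (has_bochner _ _ _); apply/funext => t; rewrite /restr /g.
  by case: ifP => _; rewrite ?subrr ?addr0// subKr.
exists (S `|` N); split.
  by split=> //; apply/(fine_mu_gt0 mufin mSN).
exists g; split.
- split=> // w; have [A hA] := mA w.
  by have [] := bint_eq mucomp mufin mSN (gb w A hA).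
- move=> w; have [A hA] := mA w.
  have [_ ->] := bint_eq mucomp mufin mSN (gb w A hA).
  by have [_ ->] := bint_eq mucomp mufin mSN hA.
- move=> t _ w w' SNw; have ww' := joinN S w w' t1 T1t1 St1 SNw.
  by rewrite /g (sj _ _ ww') (hj t _ _ ww').
have nNae : {ae mu, forall t, ~ N t} by apply: negligibleS nN => t /= /contrapT.
apply: filterS2 hV nNae => t hV nNt [St|//].
by apply: (le_lt_trans (hV St)); exact: Vexp_mono.
Qed.

(** * The large agents and their mean bundle *)

Hypothesis hA4 : A4 mu T1 Yp U a.

Lemma large_gt0 t : T1 t -> 0 < fine (mu T1).
Proof.
move=> T1t; apply: lt_le_trans (atom_gt0 T1t) _; apply: fine_mu_le => //.
  exact: atom_measurable.
by move=> _ ->.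
Qed.

Lemma large_mean_cone f w (v : Y) : join_allocation f ->
  has_bochner mu (restr T1 (fun t => f t w)) v -> Yp ((fine (mu T1))^-1 *: v).
Proof.
move=> [fp _ _] hv; apply: coneZ; first by rewrite invr_ge0 fine_ge0.
apply: (has_bochner_cone mucomp mufin cone_closed cone0 coneD coneZ _ hv).
by move=> t; rewrite /restr; case: ifP => // _; exact: cone0.
Qed.

(* (A4) bounds the average over the large agents; the integrals in it are
   finite because utilities are bounded below by their value at [0]. *)
Lemma large_agent_below_mean f (F : Om -> Y) t0 : T1 t0 -> join_allocation f ->
  (forall w, has_bochner mu (restr T1 (fun t => f t w)) (F w)) ->
  weakly_feasible mu Yp a setT f ->
  exists t1, T1 t1 /\ Vexp U q t1 (f t1) <=
    Vexp U q t1 (fun w => (fine (mu T1))^-1 *: F w).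
Proof.
move=> T1t0 fa hF fw; have [fp _ fb] := fa; pose m := fine (mu T1).
have m0 : 0 < m := large_gt0 T1t0.
have T0 : (0 < mu T1)%E by apply/(fine_mu_gt0 mufin mT1).
have Fp w : Yp (m^-1 *: F w) := large_mean_cone fa (hF w).
have fas : assignment mu Yp setT f.
  split=> // w; have [v hv] := fb w.
  have hv' : has_bochner mu (restr setT (fun t => f t w)) v by rewrite restrT.
  by have [] := bint_eq mucomp mufin measurableT hv'.
pose G w t := U t0 w (f t w) - U t0 w 0.
pose L w := U t0 w (m^-1 *: F w) - U t0 w 0.
have G0 w t : 0 <= G w t by rewrite subr_ge0 utility_ge0.
have mG w : measurable_fun setT (G w).
  apply: measurable_funB; last exact: measurable_cst.
  apply: (smeas_comp (F := fun=> U t0 w) mucomp cone_closed (allocation_smeas w fa) (fun t => fp t w)).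
    by move=> y yp; exact: measurable_cst.
  by move=> t; exact: hA2.2.
have intG w : (\int[mu]_(t in T1) (G w t)%:E <= (m * L w)%:E)%E.
  have := @hA4 t0 w T1t0 setT f; rewrite setTI => /(_ _ T0 fas fw).
  have [_ ->] := bint_eq mucomp mufin mT1 (hF w).
  move=> /(_ _)/=; rewrite -/m => A4w.
  have -> : m * L w = m * U t0 w (m^-1 *: F w) - U t0 w 0 * m.
    by rewrite /L mulrBr (mulrC m (U t0 w 0)).
  apply: integral_shift_le => //; first exact: measurable_funS (mG w).
  rewrite (eq_integral (fun t => (U t0 w (f t w))%:E)); last first.
    by move=> t _; rewrite /G subrK.
  rewrite EFinM -lee_pdivrMl//; apply: A4w; split=> //.
  by apply: lt_le_trans T0 _; apply: le_measure; rewrite ?inE.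
(* Otherwise every large agent strictly prefers its own bundle to the mean. By [A6] all of them
   evaluate with the utility and prior of [t0], so these inequalities can be integrated over [T1]
   against the bounds [intG]. *)
apply: contrapT => /forallNP nt.
have big t : T1 t -> \sum_w L w * q t0 w < \sum_w G w t * q t0 w.
  move=> T1t; have := nt t => /not_andP[//|/negP]; rewrite -ltNge /Vexp.
  have [_ -> -> _] := hA6 T1t T1t0 => h.
  rewrite /L /G; under eq_bigr do rewrite mulrBl.
  by under [ltRHS]eq_bigr do rewrite mulrBl; rewrite !sumrB ltrD2r.
pose Ls := \sum_w L w * q t0 w.
pose Phi t := \sum_w G w t * q t0 w.
have mPhi : measurable_fun setT Phi.
  by apply: measurable_sum => w; apply: measurable_funM => //; exact: measurable_cst.
have Ls0 : 0 <= Ls.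
  apply: sumr_ge0 => w _; apply: mulr_ge0; last exact/ltW/prior_gt0.
  by rewrite subr_ge0 utility_ge0.
have intPhi : (\int[mu]_(t in T1) (Phi t)%:E <= (m * Ls)%:E)%E.
  under eq_integral do rewrite /Phi -sumEFin.
  rewrite ge0_integral_sum//; last 2 first.
  - move=> w; apply/measurable_EFinP/measurable_funM; last exact: measurable_cst.
    exact: measurable_funS (mG w).
  - by move=> w t _; rewrite lee_fin mulr_ge0// ltW// prior_gt0.
  rewrite /Ls mulr_sumr -sumEFin; apply: lee_sum => w _.
  under eq_integral do rewrite mulrC EFinM.
  rewrite ge0_integralZl//; last 3 first.
  - by apply/measurable_EFinP; exact: measurable_funS (mG w).
  - by move=> t _; rewrite lee_fin.
  - by rewrite lee_fin ltW// prior_gt0.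
  rewrite mulrA [in leRHS]mulrC EFinM; apply: lee_wpmul2l => //.
  by rewrite lee_fin ltW// prior_gt0.
have : (\int[mu]_(t in T1) (Ls + (Phi t - Ls))%:E <= (m * Ls)%:E)%E.
  by rewrite (eq_integral (fun t => (Phi t)%:E))// => t _; rewrite addrC subrK.
under eq_integral do rewrite EFinD.
have mPL : measurable_fun T1 (fun t => (Phi t - Ls)%:E).
  apply/measurable_EFinP; apply: measurable_funB; last exact: measurable_cst.
  exact: measurable_funS mPhi.
have PL0 t : T1 t -> (0 <= (Phi t - Ls)%:E)%E.
  by move=> T1t; rewrite lee_fin subr_ge0 ltW//; exact: big.
rewrite ge0_integralD//.
rewrite integral_cst// -fine_muE// -EFinM -/m mulrC -[leRHS]adde0 leeD2lE//.
rewrite leNgt => /negP; apply.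
(* The excess over [Ls] is positive at [t0], and the atom [t0] alone makes its integral positive. *)
apply: (@lt_le_trans _ _ (\int[mu]_(t in [set t0]) (Phi t - Ls)%:E)%E); last first.
  by apply: ge0_subset_integral => //; [exact: atom_measurable|move=> _ ->].
rewrite (eq_integral (fun=> (Phi t0 - Ls)%:E)); last by move=> t; rewrite inE => ->.
rewrite integral_cst; last exact: atom_measurable.
rewrite -fine_muE//; last exact: atom_measurable.
by rewrite -EFinM lte_fin mulr_gt0 ?atom_gt0// subr_gt0; exact: big.
Qed.
Hypothesis hA7 : A7 T1.

(* With [lam = mu t1 / mu T1], a Lyapunov set [C] of small agents carries about
   the share [lam] of both [int (a - f)] and [int_S (a - g)].  The coalition
   [{t1} u C u S] gives [t1] the mean of [f] over the large agents, gives [f] to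
   [C] and [g] to the rest of [S]; its slack is about
   [lam int_T (a - f) + (1 - lam) int_S (a - g)]. *)
Lemma add_large_agent S f g t1 (zf z F : Om -> Y) : measurable S ->
  S `<=` ~` T1 -> T1 t1 -> join_allocation f -> join_allocation g ->
  (forall w, Yp (zf w)) ->
  (forall w, has_bochner mu (fun t => a t w - f t w) (zf w)) ->
  (forall w, interior Yp (z w)) ->
  (forall w, has_bochner mu (restr S (fun t => a t w - g t w)) (z w)) ->
  (forall w, has_bochner mu (restr T1 (fun t => f t w)) (F w)) ->
  {ae mu, forall t, S t -> Vexp U q t (f t) <= Vexp U q t (g t)} ->
  Vexp U q t1 (f t1) <= Vexp U q t1 (fun w => (fine (mu T1))^-1 *: F w) ->
  exists S0 h, [/\ measurable S0, S0 t1, join_allocation h,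
    forall w, exists2 s, interior Yp s &
      has_bochner mu (restr S0 (fun t => a t w - h t w)) s &
    {ae mu, forall t, S0 t -> Vexp U q t (f t) <= Vexp U q t (h t)}].
Proof.
move=> mS ST1 T1t1 fa ga zfp hzf zi hz hF fg ft1.
have m0 := large_gt0 T1t1; have m10 := atom_gt0 T1t1.
have mt1 := atom_measurable T1t1.
pose m := fine (mu T1); pose m1 := fine (mu [set t1]); pose lam := m1 / m.
have lam0 : 0 <= lam by rewrite divr_ge0// ltW.
(* A second atom keeps [t1] from exhausting [T1], so that [(1 - lam) *: z w] remains interior. *)
have lam1 : lam < 1.
  rewrite ltr_pdivrMr// mul1r.
  have [t2 [T1t2 t21]] : exists t2, T1 t2 /\ t2 <> t1.
    have [u [u' [T1u T1u' uu']]] := hA7.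
    have [ut1|] := pselect (u = t1); last by exists u.
    by exists u'; split=> // u't1; apply: uu'; rewrite ut1 u't1.
  have mt2 := atom_measurable T1t2.
  apply: (@lt_le_trans _ _ (fine (mu ([set t1] `|` [set t2])))).
    rewrite fine_muU//; first by rewrite ltrDl atom_gt0.
    by apply/seteqP; split=> // t [-> /= t12]; exact: t21.
  by apply: fine_mu_le => //; [exact: measurableU|move=> _ [] ->].
have mA0 : measurable (~` T1) by exact: measurableC.
(* Both net trades in all states form one finite family, so that a single set [C] serves them
   simultaneously. *)
pose H (i : bool * Om) := if i.1 then (fun t => a t i.2 - f t i.2)
  else restr S (fun t => a t i.2 - g t i.2).
have hH i : has_bochner mu (H i) (if i.1 then zf i.2 else z i.2).
  by case: i => [[] w] /=; [exact: hzf|exact: hz].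
have hr w : exists2 r : R, 0 < r & forall v : Y, `|(1 - lam) *: z w - v| < r -> Yp v.
  by apply/interiorP; apply: interiorZ => //; [exact: coneZ|rewrite subr_gt0].
pose r w := s2val (cid2 (hr w)).
have r0 w : 0 < r w := s2valP (cid2 (hr w)).
have rP w (y : Y) : `|(1 - lam) *: z w - y| < r w -> Yp y := s2valP' (cid2 (hr w)) y.
(* Two approximation errors of at most [e < r w / 4] each use less than half of the radius; the
   other half witnesses interiority. *)
have near_e w : \forall n \near \oo, n.+1%:R^-1 < r w / 4.
  have r40 : 0 < r w / 4 by rewrite divr_gt0.
  exact: near_infty_natSinv_lt (PosNum r40).
have [n _ /(_ n (leqnn n)) he] := filter_forall (f := fun w n => n.+1%:R^-1 < r w / 4) (F := \oo) _ near_e.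
pose e : R := n.+1%:R^-1.
have e0 : 0 < e by rewrite invr_gt0.
have lam01 : 0 <= lam <= 1 by rewrite lam0 ltW.
have [C [mC CT1 hC]] := approx_lyapunov mucomp mufin mA0 economy_atomless lam01 e0 hH.
pose fhat w := m^-1 *: F w.
pose h t := if t \in [set t1] then fhat else if t \in C then f t else g t.
have fj : join_meas Pi setT fhat.
  move=> w w' ww'; rewrite /fhat; congr (_ *: _).
  apply: (has_bochner_unique mucomp mufin (hF w)).
  have := hF w'; congr (has_bochner _ _ _); congr restr; apply/funext => t.
  by have [_ fj _] := fa; rewrite (fj t _ _ ww').
have t1C : t1 \in C = false by apply/negP => /set_mem/CT1; exact.
have t1S : t1 \in S = false by apply/negP => /set_mem/ST1; exact.
exists ([set t1] `|` (C `|` S)), h; split.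
- by apply: measurableU => //; exact: measurableU.
- by left.
- apply: join_allocation_if => //; last exact: join_allocation_if.
  by apply: join_allocation_cst => // w; exact: large_mean_cone (hF w).
- move=> w.
  have [wC hwC] := has_bochner_restr mucomp mufin mC (hH (true, w)).
  have [wC' hwC'] := has_bochner_restr mucomp mufin mC (hH (false, w)).
  have [w0 hw0] := has_bochner_restr mucomp mufin mA0 (hH (true, w)).
  have hz0 : has_bochner mu (restr (~` T1) (H (false, w))) (z w).
    by rewrite /H /= restrI setIidr.
  have eC := hC _ _ _ hwC hw0; have eC' := hC _ _ _ hwC' hz0.
  (* Large agents have equal endowments, so the left side is the net trade of [f] on [T1]: the total
     [zf w] minus the part [w0] of the small agents. *)
  have EF : m *: a t1 w - F w = zf w - w0.
    apply: (has_bochner_unique mucomp mufin (h := restr T1 (fun t => a t w - f t w))).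
      have := has_bochnerB mucomp (has_bochner_restr_cst mu (a t1 w) mT1) (hF w).
      congr (has_bochner _ _ _); apply/funext => t; rewrite /restr.
      case: ifPn => tT1; last by rewrite subrr.
      by have [_ _ _ ->] := hA6 T1t1 (set_mem tT1).
    have := has_bochnerB mucomp (hzf w) hw0.
    congr (has_bochner _ _ _); apply/funext => t; rewrite /restr /H in_setC /=.
    by case: (t \in T1); rewrite ?subr0 ?subrr.
  have Em1 : m1 *: (a t1 w - fhat w) = lam *: (zf w - w0).
    by rewrite -EF /lam /fhat !scalerBr !scalerA divfK// gt_eqF.
  exists (m1 *: (a t1 w - fhat w) + (wC + (z w - wC'))); last first.
    have := has_bochnerD mucomp
      (has_bochner_restr_cst mu (a t1 w - fhat w) mt1)
      (has_bochnerD mucomp hwC (has_bochnerB mucomp (hz w) hwC')).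
    congr (has_bochner _ _ _); apply/funext => t.
    rewrite /restr /H /h !in_setU /restr /=.
    have [->|tt1] := eqVneq t t1.
      by rewrite mem_set//= t1C t1S subrr !addr0.
    rewrite (_ : t \in [set t1] = false) /=; last by apply/negP => /set_mem/eqP; exact/negP.
    by case: (t \in C); case: (t \in S); rewrite ?subrr ?subr0 ?addr0 ?add0r.
  (* The slack is a cone element, plus an interior element, plus the two errors of the set [C]. *)
  have -> : m1 *: (a t1 w - fhat w) + (wC + (z w - wC')) = lam *: zf w +
      ((1 - lam) *: z w + ((wC - lam *: w0) - (wC' - lam *: z w))).
    rewrite Em1 scalerBr -addrA; congr (_ + _).
    by rewrite scalerBl scale1r opprB [RHS]addrCA subrKA addrA (addrC wC).
  apply: interiorD; [exact: coneD|exact: coneZ|].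
  apply/interiorP; exists (r w / 2); first by rewrite divr_gt0.
  move=> y hy; apply: (rP w).
  rewrite -(subrKA ((1 - lam) *: z w + (wC - lam *: w0 - (wC' - lam *: z w)))).
  apply: (le_lt_trans (ler_normD _ _)).
  rewrite opprD addNKr normrN.
  have := ler_normB (wC - lam *: w0) (wC' - lam *: z w).
  by have := he w; rewrite -/e; move: hy eC eC'; lra.
apply: filterS fg => t fgt [->|CS].
  by rewrite /h mem_set.
rewrite /h; have -> : t \in [set t1] = false.
  apply/negP => /set_mem /= tt1; move: CS; rewrite tt1.
  by move=> [/CT1|/ST1]; exact.
by case: ifPn => // tC; apply: fgt; case: CS => // Ct; move/negP : tC; rewrite inE.
Qed.

(** * Equality of the two cores *)

Lemma bint_endowment S w : measurable S ->
  has_bochner mu (restr S (fun t => a t w)) (bint mu S (fun t => a t w)).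
Proof.
move=> mS; have [A hA] := has_bochner_restr mucomp mufin mS (endowment_bochner w).
by have [_ ->] := bint_eq mucomp mufin mS hA.
Qed.

Lemma weak_fine_core_private_core f :
  weak_fine_core mu Yp Pi U q a f <-> private_core_s mu Yp Pi U q a f.
Proof.
split; last first.
  (* Every fine block is a private block: pooling over all agents only refines the information of
     [S], and exact feasibility leaves the slack 0, which lies in the cone. *)
  move=> [[fas fj] ffeas fnb]; split=> //.
    by apply: filterS fj => t; exact.
  move=> S coS [g [gas gex gj gV]].
  apply: (fnb S coS); exists g; split=> //.
    split=> //; apply: aeW => t St w w' ww'; apply: (gj t St) => s Ss.
    exact: ww'.
  by move=> w; rewrite /yle gex subrr; exact: cone0.
move=> [[fas ffeas] fj fnb].
have fjT : {ae mu, forall t, setT t -> join_meas Pi setT (f t)}.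
  by apply: filterS fj => t.
split=> // S [mS S0] [g [[gas gj] gfeas gV]].
have [f0 [f0a f0b f0f]] := normalize_allocation measurableT fas fjT.
have [g0 [g0a g0b g0g]] := normalize_allocation mS gas gj.
have restrB S' (h : T -> Om -> Y) w : restr S' (fun t => a t w - h t w) =
    (fun t => restr S' (fun s => a s w) t - restr S' (fun s => h s w) t).
  by apply/funext => t; rewrite /restr; case: ifP; rewrite ?subrr.
have hz w : has_bochner mu (restr S (fun t => a t w - g0 t w))
    (bint mu S (fun t => a t w) - bint mu S (fun t => g t w)).
  by rewrite restrB; apply: has_bochnerB => //; exact: bint_endowment.
have hzf w : has_bochner mu (fun t => a t w - f0 t w)
    (bint mu setT (fun t => a t w) - bint mu setT (fun t => f t w)).
  rewrite -(restrT (fun t => a t w - f0 t w)) restrB.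
  by apply: has_bochnerB => //; exact: bint_endowment.
have f0g0 : {ae mu, forall t, S t -> Vexp U q t (f0 t) < Vexp U q t (g0 t)}.
  apply: filterS2 f0f (filterI g0g gV) => t ff0 [gg0 fg] St.
  by rewrite ff0// gg0//; exact: fg.
have [g' [z [g'a zi zb f0g']]] := interior_slack mS S0 f0a g0a gfeas hz f0g0.
have ae_f h S' : {ae mu, forall t, S' t -> Vexp U q t (f0 t) <= Vexp U q t (h t)} ->
    {ae mu, forall t, S' t -> Vexp U q t (f t) <= Vexp U q t (h t)}.
  by apply: filterS2 f0f => t ff0 + St => /(_ St); rewrite ff0.
suff [S' [S'co]] : exists S', coalition mu S' /\ NY_fine_blocked mu Yp Pi U q a f S'.
  exact: fnb.
have [[t1 [St1 T1t1]]|ST1] := pselect (exists t, S t /\ T1 t).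
  apply: (NY_blocked_of_slack mS T1t1 St1 g'a _ (ae_f _ _ f0g')) => w.
  by exists (z w).
have {}ST1 : S `<=` ~` T1 by move=> t St T1t; apply: ST1; exists t.
have [t0 [_ [T1t0 _ _]]] := hA7.
have hF w : exists v, has_bochner mu (restr T1 (fun t => f0 t w)) v.
  have [_ _ /(_ w)[v hv]] := f0a; exact: has_bochner_restr hv.
pose F w := sval (cid (hF w)).
have hF' w : has_bochner mu (restr T1 (fun t => f0 t w)) (F w) := svalP (cid (hF w)).
have f0feas : weakly_feasible mu Yp a setT f0.
  by move=> w; have [_ ->] := bint_eq mucomp mufin measurableT (f0b w); exact: ffeas.
have [t1 [T1t1 ft1]] := large_agent_below_mean T1t0 f0a hF' f0feas.
have [S' [h [mS' S't1 ha hs hV]]] :=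
  add_large_agent mS ST1 T1t1 f0a g'a ffeas hzf zi zb hF' f0g' ft1.
exact: (NY_blocked_of_slack mS' T1t1 S't1 ha hs (ae_f _ _ hV)).
Qed.

End Economy.

Theorem theorem4p16 (d : measure_display) (T : measurableType d) (R : realType)
  (Y : completeNormedModType R) (Om : finType)
  (mu : {measure set T -> \bar R}) (T1 : set T) (Yp : set Y)
  (Pi : T -> {set {set Om}}) (U : T -> Om -> Y -> R) (q : T -> Om -> R)
  (a : T -> Om -> Y)
  (hE : economy mu T1 Yp Pi U q a)
  (hA1 : A1 mu Pi q) (hA2 : A2 Yp U) (hA3 : A3 Yp U)
  (hA4 : A4 mu T1 Yp U a) (hA5 : A5 Yp a) (hA6 : A6 T1 Pi U q a) (hA7 : A7 T1)
  (f : T -> Om -> Y) :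
  weak_fine_core mu Yp Pi U q a f <-> private_core_s mu Yp Pi U q a f.
Proof.
exact: (weak_fine_core_private_core hE hA2 hA3 hA5 hA1 hA6 hA4 hA7).
Qed.
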